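(* There exists a universal constant $0<\beta\le 1680e$ (in particular independent of the dimension) such that for every $n\ge 1$ and every symmetric random vector $X=(X_1,\dots,X_n)$ with values in $\mathbb{R}^n$ and with independent coordinates with log-concave tails, $X$ satisfies convex $\mathrm{IC}(\beta)$; that is, for every convex function $f:\mathbb{R}^n\to\mathbb{R}$ bounded from below, $$\mathbb{E}\, e^{(f\,\square\,\varphi)(X)}\;\mathbb{E}\, e^{-f(X)}\le 1,\qquad\text{where } \varphi(x)=\Lambda_X^*(x/\beta).$$
   Context: A random vector $X$ is symmetric if $X$ and $-X$ have the same distribution. A real random variable $Y$ has log-concave tails if $t\mapsto -\ln\mathbb{P}(|Y|\ge t)\in[0,\infty]$ is convex on $[0,\infty)$ (with $-\ln 0=+\infty$). For a random vector $X$ in $\mathbb{R}^n$, $\Lambda_X(y)=\ln\mathbb{E}\,e^{\langle y,X\rangle}\in(-\infty,\infty]$ is the cumulant-generating function and $\Lambda_X^*(x)=\sup_{y\in\mathbb{R}^n}\{\langle x,y\rangle-\Lambda_X(y)\}\in[0,\infty]$ is its Legendre transform. For $f:\mathbb{R}^n\to\mathbb{R}$ and $\varphi:\mathbb{R}^n\to[0,\infty]$, the infimum convolution is $(f\,\square\,\varphi)(x)=\inf\{f(y)+\varphi(x-y):y\in\mathbb{R}^n\}$. A pair $(X,\varphi)$ satisfies the convex infimum convolution inequality if $\mathbb{E}\,e^{(f\square\varphi)(X)}\,\mathbb{E}\,e^{-f(X)}\le 1$ for every convex $f:\mathbb{R}^n\to\mathbb{R}$ bounded from below. $X$ satisfies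 convex $\mathrm{IC}(\beta)$ if the pair $(X,\Lambda_X^*(\cdot/\beta))$ satisfies the convex infimum convolution inequality. *)

(* Defs.v *)
From HB Require Import structures.
From mathcomp Require Import all_boot all_order all_algebra.
From mathcomp Require Import all_classical all_reals all_analysis.

Set Implicit Arguments.
Unset Strict Implicit.
Unset Printing Implicit Defensive.

Import Order.TTheory GRing.Theory Num.Theory.
Import numFieldNormedType.Exports.

Local Open Scope classical_set_scope.
Local Open Scope ring_scope.

(* R^n with its Borel sigma-algebra; a random vector on a probability space
   (T, P) is an element of {RV P >-> borel_rV R n}. *)
Notation borel_rV R n := (g_sigma_algebraType (@open 'rV[R]_n)).

Definition dotr (R : realType) (n : nat) (u v : 'rV[R]_n) : R :=
  \sum_(i < n) u ord0 i * v ord0 i.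

Definition coordinate (R : realType) (n : nat) (T : Type) (X : T -> 'rV[R]_n)
  (i : 'I_n) : T -> R := fun w => X w ord0 i.

Section random_vectors.
Local Open Scope ereal_scope.
Context (R : realType) (d : measure_display) (T : measurableType d)
  (P : probability T R).

Definition symmetric_rV (n : nat) (X : {RV P >-> borel_rV R n}) : Prop :=
  forall A : set (borel_rV R n), measurable A ->
    P (X @^-1` A) = P ((fun w => - (X w : 'rV[R]_n))%R @^-1` A).

Definition independent_family (n : nat) (Y : 'I_n -> T -> R) : Prop :=
  forall (J : {set 'I_n}) (B : 'I_n -> set R),
    (forall i, measurable (B i)) ->
    P (\bigcap_(i in [set` J]) (Y i @^-1` B i)) =
    \prod_(i in J) P (Y i @^-1` B i).

(* lne 0 = -oo, so this is +oo where the tail vanishes. *)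
Definition neg_log_tail (Y : T -> R) (t : R) : \bar R :=
  - lne (P [set w | (t <= `|Y w|)%R]).

(* neg_log_tail is nonnegative, so the right-hand side never involves
   +oo - oo; recall 0 * +oo = 0. *)
Definition log_concave_tails (Y : T -> R) : Prop :=
  forall s t l : R, (0 <= s)%R -> (0 <= t)%R -> (0 <= l <= 1)%R ->
    neg_log_tail Y ((1 - l) * s + l * t)%R <=
    (1 - l)%:E * neg_log_tail Y s + l%:E * neg_log_tail Y t.

Definition cumulant_gf (n : nat) (X : T -> 'rV[R]_n) (y : 'rV[R]_n) : \bar R :=
  lne 'E_P[fun w => expR (dotr y (X w))].

End random_vectors.

Section infimum_convolution.
Local Open Scope ereal_scope.
Context (R : realType) (n : nat).

Definition legendre (L : 'rV[R]_n -> \bar R) (x : 'rV[R]_n) : \bar R :=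
  ereal_sup [set (dotr x y)%:E - L y | y in [set: 'rV[R]_n]].

Definition infconv (f : 'rV[R]_n -> R) (phi : 'rV[R]_n -> \bar R)
    (x : 'rV[R]_n) : \bar R :=
  ereal_inf [set (f y)%:E + phi (x - y)%R | y in [set: 'rV[R]_n]].

Definition bounded_below (f : 'rV[R]_n -> R) : Prop :=
  exists m : R, forall x, (m <= f x)%R.

Context (d : measure_display) (T : measurableType d) (P : probability T R).

(* The first expectation is an integral of an extended-real function because
   the infimum convolution is extended-real valued. *)
Definition convex_infconv_ineq (X : {RV P >-> borel_rV R n})
    (phi : 'rV[R]_n -> \bar R) : Prop :=
  forall f : 'rV[R]_n -> R,
    @convex_function R 'rV[R]_n setT f -> bounded_below f ->
    (\int[P]_w expeR (infconv f phi (X w))) *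
      'E_P[fun w => expR (- f (X w))] <= 1.

Definition convex_IC (X : {RV P >-> borel_rV R n}) (beta : R) : Prop :=
  convex_infconv_ineq X
    (fun x => legendre (cumulant_gf P X) (beta^-1 *: x)%R).

End infimum_convolution.

(* Main.v *)
Require Import Defs.
From HB Require Import structures.
From mathcomp Require Import all_boot all_order all_algebra.
From mathcomp Require Import all_classical all_reals all_analysis.
From mathcomp Require Import measurable_realfun ring lra.

Set Implicit Arguments.
Unset Strict Implicit.
Unset Printing Implicit Defensive.

Import Order.TTheory GRing.Theory Num.Theory.
Import numFieldNormedType.Exports.

Local Open Scope classical_set_scope.
Local Open Scope ring_scope.

(** Write phi for the cost Lambda^* (. / beta).  On the line, choose a scale w
    with P(|X| >= w) <= 1/e <= P(|X| >= w/4).  Log-concavity makes the tails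
    subexponential at scale w, while Lambda^* (s) <= ln 2 - ln P(|X| >= s) and
    Lambda^* is at most quadratic near 0: phi is small compared with the decay
    of the tails.  Cutting f at its minimum reduces to monotone f, say
    nondecreasing with f (-32 w) = 0.
    - If f (-16 w) <= 4, the sum of the two expectations is at most 2.  Indeed
      e^(f [] phi) + e^(-f) - 2 is pointwise at most 20 b^2 - a^2 / 10, where a
      is a truncation of f and b its translate by 64 w, up to a loss far on the
      left and one far on the right, and E b^2 is much smaller than E a^2.
    - Otherwise f lies above an affine function with which it agrees at a point
      z of [-8 t, -t], of slope p / t where e^(-p) is comparable to the tail
      around t.  The infimum convolution is estimated by moving halfway towards
      z, and both expectations become exponential moments of X.

    For independent coordinates, infimum-convolve in the first coordinate only
    and set F y = ln E e^(q (X_0, y)), with q the partial infimum convolution.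
    F is convex, the one-dimensional inequality bounds E e^(-f (X_0, y)) by
    e^(- F y), and induction applies to F. *)

(** * Convex functions and infimum convolutions *)

Section convexity.
Context {R : realType}.
Implicit Types V : lmodType R.

(** [Lambda^*] is never computed: the proof uses only two upper bounds for it, the quadratic one
    near 0 and the one that Chernoff's inequality gives at a point s. Dividing the argument by beta
    lets a jump of order s cost only a fraction of [- ln P(|X| >= s)], so that the exponential of
    the cost is integrable with room to spare. The value 3360 of beta answers to numerical
    requirements of this kind; the closest ones are that a jump of [64 w] costs at most 1/40 and,
    for steep f, that [16 t <= beta t / 192].

    The obstacle that separates the two cases is a nearly constant f. Both expectations are then 1
    up to a small error and the product has no slack. In the sum [e^(f [] phi) + e^(-f)] the
    first-order terms cancel, and a sum at most 2 gives a product at most 1; the gain has to be of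
    second order, hence the squares. A steep f leaves a constant factor to spare, and crude moment
    bounds suffice.

    In the induction on the dimension, convexity of F is Hölder's inequality combined with the joint
    convexity of f and of the cost; this is why costs are required to be convex. *)

Definition cvx V (f : V -> R) := forall l x y, 0 <= l <= 1 ->
  f (l *: x + (1 - l) *: y) <= l * f x + (1 - l) * f y.

Lemma convex_function_cvx V (f : V -> R) :
  @convex_function R V setT f -> cvx f.
Proof.
move=> cf l x y l01.
have li : Itv.spec (@Itv.num_sem R) (Itv.Real `[0%Z, 1%Z]) l.
  by rewrite /Itv.spec /Itv.num_sem /= num_real /= in_itv /=.
have := cf (Itv.mk li) x y (in_setT _) (in_setT _).
by [].
Qed.

Lemma cvx_addr V (f : V -> R) c : cvx f -> cvx (fun x => f x + c).
Proof. by move=> cf l x y l01; have := cf l x y l01; nra. Qed.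

Lemma cvx_half V (f : V -> R) x y : cvx f ->
  f (2^-1 *: (x + y)) <= 2^-1 * (f x + f y).
Proof.
move=> cf; have := cf 2^-1 x y.
have -> : (1 - 2^-1 : R) = 2^-1 by lra.
rewrite -scalerDr -mulrDr; apply; apply/andP; split; lra.
Qed.

(** For [s] of either sign, [x + s *: e] is a convex combination of [x] and one of [x + e],
    [x - e]. *)
Lemma cvx_step V (f : V -> R) x e s : cvx f -> `|s| <= 1 ->
  f (x + s *: e) <= f x + `|s| * (`|f (x + e)| + `|f (x - e)| + `|f x|).
Proof.
move=> cf s1.
have hs : 0 <= `|s| <= 1 by rewrite normr_ge0.
have bnd y : f y <= `|f y| := ler_norm _.
have n0 y : 0 <= `|f y| := normr_ge0 _.
have bx : - `|f x| <= f x by rewrite lerNl -normrN ler_norm.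
have [s0|s0] := leP 0 s.
  have E : `|s| *: (x + e) + (1 - `|s|) *: x = x + s *: e.
    by rewrite ger0_norm// scalerDr scalerBl scale1r addrC addrA subrK.
  have := cf `|s| (x + e) x hs; rewrite E.
  have := bnd (x + e); have := n0 (x - e); have := n0 x; move: hs bx.
  by nra.
have E : `|s| *: (x - e) + (1 - `|s|) *: x = x + s *: e.
  rewrite ltr0_norm// scalerBr opprK scalerDl scale1r !scaleNr opprK.
  by rewrite addrC addrA addrK.
have := cf `|s| (x - e) x hs; rewrite E.
have := bnd (x - e); have := n0 (x + e); have := n0 x; move: hs bx.
by nra.
Qed.

(** As [x] is the midpoint of [x + h] and [x - h], upper bounds on increments of a convex function
    become two-sided. *)
Lemma cvx_refl V (f : V -> R) x h : cvx f -> f x - f (x + h) <= f (x - h) - f x.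
Proof.
move=> cf; have := cvx_half (x + h) (x - h) cf.
rewrite addrACA subrr addr0 scalerDr -scalerDl.
have -> : (2^-1 + 2^-1 : R) = 1 by lra.
by rewrite scale1r; lra.
Qed.

Lemma cvx_real_continuous (f : R -> R) : cvx (f : R^o -> R) -> continuous f.
Proof.
move=> cf x.
pose M := `|f (x + 1)| + `|f (x - 1)| + `|f x| + 1.
have M0 : 0 < M by rewrite /M; have := normr_ge0 (f (x + 1));
  have := normr_ge0 (f (x - 1)); have := normr_ge0 (f x); lra.
have up s : `|s| <= 1 -> f (x + s) - f x <= `|s| * M.
  move=> s1; have := @cvx_step R^o f x 1 s cf s1.
  have -> : s *: (1 : R^o) = s by rewrite /GRing.scale /= mulr1.
  by have := normr_ge0 s; rewrite /M; nra.
have key s : `|s| <= 1 -> `|f (x + s) - f x| <= `|s| * M.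
  move=> s1; rewrite ler_norml up// andbT lerNl opprB.
  apply: le_trans (@cvx_refl R^o f x s cf) _.
  by have := up (- s); rewrite normrN; apply.
apply/cvgrPdist_le => e e0.
exists (Num.min 1 (e / M)) => /=; first by rewrite lt_min ltr01 divr_gt0.
move=> y /=; rewrite lt_min => /andP[y1 ye].
have -> : y = x + (y - x) by rewrite addrC subrK.
rewrite distrC; apply: le_trans (key _ _) _; first by rewrite distrC ltW.
by rewrite distrC -ler_pdivlMr// ltW.
Qed.

(** Only the first [k] coordinates of [h] may be nonzero; the induction is on [k]. In the step,
    [x + h] is the midpoint of a point displaced in the first [k] coordinates and a point displaced
    along the next one, both by twice as much; hence the radius [2^-1 ^+ k]. *)
Lemma cvx_rV_upper n (f : 'rV[R]_n -> R) (x : 'rV[R]_n) (k : nat) : cvx f ->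
  exists2 K, 0 <= K & forall (e : R) (h : 'rV[R]_n), e <= 2^-1 ^+ k ->
    (forall i, `|h ord0 i| <= e) -> (forall i : 'I_n, (k <= i)%N -> h ord0 i = 0) ->
    0 <= e -> f (x + h) <= f x + K * e.
Proof.
move=> cf; elim: k => [|k [K K0 IH]].
  exists 0 => // e h _ _ h0 _.
  have -> : h = 0 by apply/rowP => i; rewrite mxE h0.
  by rewrite addr0 mul0r addr0.
have [kn|nk] := ltnP k n; last first.
  exists K => // e h ek he h0 e0; apply: IH => //.
  - apply: le_trans ek _; rewrite exprS ler_piMl ?exprn_ge0//; lra.
  - by move=> i ki; have := leq_trans nk ki; rewrite leqNgt ltn_ord.
pose ik := Ordinal kn.
pose E : 'rV[R]_n := delta_mx ord0 ik.
pose N := `|f (x + E)| + `|f (x - E)| + `|f x|.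
have N0 : 0 <= N by rewrite /N !addr_ge0.
exists (K + N); first by rewrite addr_ge0.
move=> e h ek he h0 e0.
pose s := h ord0 ik.
pose h' := h - s *: E.
have -> : x + h = 2^-1 *: ((x + 2 *: h') + (x + (2 * s) *: E)).
  apply/rowP => i; rewrite /h' !mxE; lra.
apply: le_trans (cvx_half _ _ cf) _.
have e1 : 2 * e <= 2^-1 ^+ k by move: ek; rewrite exprS; lra.
have I1 : f (x + 2 *: h') <= f x + K * (2 * e).
  apply: IH => //; last by lra.
    move=> i; rewrite /h' !mxE eqxx/=; have [->|ne] := eqVneq i ik.
      by rewrite mulr1 subrr mulr0 normr0; lra.
    by rewrite mulr0 subr0 normrM ger0_norm// ler_pM2l.
  move=> i; rewrite leq_eqVlt => /orP[/eqP ki|ki]; rewrite /h' !mxE eqxx/=.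
    have -> : i = ik by apply/val_inj; rewrite /= ki.
    by rewrite eqxx mulr1 subrr mulr0.
  by rewrite h0// -(inj_eq val_inj)/= gtn_eqF// mulr0 subr0 mulr0.
have s2 : `|2 * s| <= 2 * e by rewrite normrM ger0_norm// ler_pM2l// he.
have I2 : f (x + (2 * s) *: E) <= f x + `|2 * s| * N.
  apply: cvx_step => //; apply: le_trans s2 (le_trans e1 _).
  by rewrite exprn_ile1//; lra.
by nra.
Qed.

Lemma cvx_rV_continuous n (f : 'rV[R]_n -> R) : cvx f -> continuous f.
Proof.
move=> cf x.
have [K K0 HK] := cvx_rV_upper x n cf.
have up e (h : 'rV[R]_n) : 0 <= e -> e <= 2^-1 ^+ n -> (forall i, `|h ord0 i| <= e) ->
    f (x + h) - f x <= K * e.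
  move=> e0 en he; rewrite lerBlDl; apply: HK => // i.
  by rewrite leqNgt ltn_ord.
have key e (h : 'rV[R]_n) : 0 <= e -> e <= 2^-1 ^+ n -> (forall i, `|h ord0 i| <= e) ->
    `|f (x + h) - f x| <= K * e.
  move=> e0 en he; rewrite ler_norml up// andbT lerNl opprB.
  apply: le_trans (cvx_refl x h cf) _; apply: up => // i.
  by rewrite mxE normrN.
apply/(@cvgrPdist_le _ R^o _ (nbhs x) (nbhs_filter x)) => e e0.
pose d := Num.min (2^-1 ^+ n) (e / (K + 1)).
have K1 : 0 < K + 1 by lra.
have d0 : 0 < d by rewrite lt_min exprn_gt0 ?divr_gt0// invr_gt0.
apply/nbhs_ballP; exists d => //= y [_ yd].
have -> : y = x + (y - x) by rewrite addrC subrK.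
rewrite distrC; apply: le_trans (key d (y - x) _ _ _) _.
- exact: ltW.
- by rewrite ge_min lexx.
- by move=> i; rewrite !mxE distrC ltW//; have := yd ord0 i.
have : d <= e / (K + 1) by rewrite ge_min lexx orbT.
by rewrite ler_pdivlMr//; nra.
Qed.

End convexity.

Section infimum_convolution.
Context {R : realType}.
Implicit Types V : lmodType R.

(* [C h r] stands for [phi h <= r], where phi is a convex cost with values in
   [0, +oo] and phi 0 = 0; this keeps infimum convolutions real-valued. *)
Record convex_cost V (C : V -> R -> Prop) := ConvexCost {
  cost_ge0 : forall h r, C h r -> 0 <= r ;
  cost00 : C 0 0 ;
  cost_cvx : forall l h r h' r', 0 <= l <= 1 -> C h r -> C h' r' ->
    C (l *: h + (1 - l) *: h') (l * r + (1 - l) * r') }.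

(** A real [inf] has a default value on sets that are empty or unbounded below; [cost00] excludes
    the former, a lower bound on [f] and [cost_ge0] the latter. *)
Definition infc V (C : V -> R -> Prop) (f : V -> R) (x : V) : R :=
  inf [set s | exists h r, C h r /\ s = f (x - h) + r].

Section theory.
Variables (V : lmodType R) (C : V -> R -> Prop) (f : V -> R).
Hypotheses (cC : convex_cost C) (fb : exists m, forall x, m <= f x).

Let has_infC x : has_inf [set s | exists h r, C h r /\ s = f (x - h) + r].
Proof.
split; first by exists (f x); exists 0, 0; split; [exact: cost00|rewrite subr0 addr0].
have [m hm] := fb; exists m => _ [h [r [/(cost_ge0 cC) r0 ->]]].
by have := hm (x - h); lra.
Qed.

Lemma infc_le x h r : C h r -> infc C f x <= f (x - h) + r.
Proof. by move=> hr; apply: ge_inf; [case: (has_infC x)|exists h, r]. Qed.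

Lemma infc_ge x s : (forall h r, C h r -> s <= f (x - h) + r) -> s <= infc C f x.
Proof.
move=> H; apply: lb_le_inf; first by case: (has_infC x).
by move=> _ [h [r [hr ->]]]; exact: H.
Qed.

Lemma infc_le_id x : infc C f x <= f x.
Proof. by have := infc_le x (cost00 cC); rewrite subr0 addr0. Qed.

Lemma infc_lt x s : infc C f x < s -> exists h r, C h r /\ f (x - h) + r < s.
Proof.
by move=> /(inf_lt (has_infC x).1)[_ [h [r [hr ->]]] ?]; exists h, r.
Qed.

Lemma infc_addr c x : infc C (fun x => f x + c) x = infc C f x + c.
Proof.
have fcb : exists m, forall x, m <= f x + c.
  by have [m hm] := fb; exists (m + c) => y; rewrite lerD2r.
apply/eqP; rewrite eq_le; apply/andP; split.
  rewrite -lerBlDr; apply: infc_ge => h r hr; rewrite lerBlDr.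
  apply: (@le_trans _ _ (f (x - h) + c + r)); last by rewrite addrAC.
  by apply: ge_inf; [have [m hm] := fcb; exists m => _ [k [s [/(cost_ge0 cC) s0 ->]]];
    have := hm (x - k); lra|exists h, r].
apply: lb_le_inf; first by exists (f x + c); exists 0, 0; split; [exact: cost00|
  rewrite subr0 addr0].
by move=> _ [h [r [hr ->]]]; have := infc_le x hr; lra.
Qed.

End theory.

Lemma infc_lb V C (f : V -> R) x m : convex_cost C -> (forall x, m <= f x) ->
  m <= infc C f x.
Proof.
move=> cC hm; apply: infc_ge => //; first by exists m.
by move=> h r /(cost_ge0 cC) r0; have := hm (x - h); lra.
Qed.

End infimum_convolution.

(** * Elementary inequalities for the exponential *)

Section exponential_inequalities.
Context {R : realType}.
Implicit Types a b f k p q r t v w x y : R.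

Lemma cvx_expR : cvx (@expR R : R^o -> R).
Proof.
apply: convex_function_cvx => t x y _ _; exact: convex_expR.
Qed.

Lemma expR_le_invB x : x < 1 -> expR x <= (1 - x)^-1.
Proof.
move=> x1; rewrite -[x in expR x]opprK expRN lef_pV2 ?posrE ?expR_gt0//; last by lra.
exact: expR_ge1Dx.
Qed.

(** From [e^x >= 1 + x] and [(1 + x) (1 - x + x^2) = 1 + x^3 >= 1]. *)
Lemma expRN_le_quadratic x : 0 <= x -> expR (- x) <= 1 - x + x ^+ 2.
Proof.
move=> x0; rewrite expRN -[leRHS]invrK lef_pV2 ?posrE ?invr_gt0 ?expR_gt0//; last by nra.
apply: le_trans (expR_ge1Dx x); rewrite -[leRHS]invrK lef_pV2 ?posrE ?invr_gt0//; [|nra|nra].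
by rewrite -[(_)^-1]mul1r ler_pdivrMr; nra.
Qed.

Lemma expR_le_quadratic x : 0 <= x <= 10^-1 -> expR x <= 1 + x + 9 / 8 * x ^+ 2.
Proof.
move=> x0; apply: le_trans (expR_le_invB _) _; first by lra.
by rewrite -[(_)^-1]mul1r ler_pdivrMr; nra.
Qed.

Lemma cosh_le x : 0 <= x -> expR x + expR (- x) - 2 <= x ^+ 2 * expR x.
Proof.
move=> x0; have e0 := expR_gt0 x.
have -> : expR x + expR (- x) - 2 = expR x * (1 - expR (- x)) ^+ 2.
  by rewrite expRN; field; rewrite gt_eqF.
rewrite mulrC ler_pM2r//.
have := expR_ge1Dx (- x); have : expR (- x) <= 1 by rewrite expR_le1; lra.
by nra.
Qed.

Lemma sqr_le_expR x : 0 <= x -> x ^+ 2 <= expR x.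
Proof.
move=> x0; have -> : x = 4%:R * (x / 4) by field.
rewrite expRM_natl; have := expR_ge1Dx (x / 4).
have : 0 <= (x / 4 - 1) ^+ 2 by exact: sqr_ge0.
set e := expR _ => h1 h2; have e0 : 0 <= x / 4 by lra.
have h3 : x <= e ^+ 2 by nra.
have -> : e ^+ 4 = (e ^+ 2) ^+ 2 by rewrite -exprM.
have -> : 4%:R * (x / 4) = x by field.
by rewrite ler_pXn2r ?nnegrE// sqr_ge0.
Qed.

(** Jensen: [q v - q^2] is the mean of [v - q] and [q - v] with weights [(1 + q) / 2] and
    [(1 - q) / 2], and [1 + q <= e^q]. In other words, a fair sign has rate at most [q^2] at [q]. *)
Lemma expR_le_cosh q v : `|q| <= 1 ->
  expR (q * v - q ^+ 2) <= (expR v + expR (- v)) / 2.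
Proof.
rewrite ler_norml => /andP[q1 q2].
have := @cvx_expR ((1 + q) / 2) (v - q) (q - v).
rewrite /GRing.scale/=.
have -> : (1 + q) / 2 * (v - q) + (1 - (1 + q) / 2) * (q - v) = q * v - q ^+ 2.
  by field.
move=> /(_ _)/le_trans; apply; first by lra.
have h1 := expR_ge1Dx q; have h2 := expR_ge1Dx (- q).
have -> : expR v = expR q * expR (v - q) by rewrite -expRD; congr expR; ring.
have -> : expR (- v) = expR (- q) * expR (q - v) by rewrite -expRD; congr expR; ring.
have := expR_gt0 (v - q); have := expR_gt0 (q - v).
by nra.
Qed.

(** Jensen once more, with weights [p] and [1 - p]: a fair sign kept with probability [p] and
    replaced by 0 otherwise has rate at most [r^2 / p] at [r]. *)
Lemma expR_le_mixture_cosh p r v : 0 < p <= 1 -> `|r| <= p ->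
  expR (r * v - r ^+ 2 / p) <= 1 + p * ((expR v + expR (- v)) / 2 - 1).
Proof.
move=> /andP[p0 p1] rp; have q1 : `|r / p| <= 1.
  by rewrite normrM normfV (gtr0_norm p0) ler_pdivrMr// mul1r.
have := expR_le_cosh v q1; set C := (_ + _) / 2 => h.
have := @cvx_expR p (r / p * v - (r / p) ^+ 2) 0.
rewrite /GRing.scale/= mulr0 addr0 expR0.
have -> : p * (r / p * v - (r / p) ^+ 2) = r * v - r ^+ 2 / p.
  by field; rewrite gt_eqF.
move=> /(_ _)/le_trans; apply; first by lra.
by nra.
Qed.

Lemma expRN1_ge : 4^-1 <= expR (-1) :> R.
Proof.
rewrite expRN lef_pV2 ?posrE ?expR_gt0//.
have -> : expR 1 = expR 2^-1 ^+ 2 :> R by rewrite -expRM_natl; congr expR; field.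
have : expR (2^-1 : R) <= 2.
  apply: le_trans (expR_le_invB _) _; first by lra.
  by rewrite -[(_)^-1]mul1r ler_pdivrMr; lra.
by have := expR_gt0 (2^-1 : R); nra.
Qed.

Lemma expR1_ge : 2 <= expR 1 :> R.
Proof. by have := expR_ge1Dx (1 : R); lra. Qed.

Lemma expRN_nat_le n : expR (- n%:R) <= 2^-1 ^+ n :> R.
Proof.
rewrite expRN -[X in expR X]mulr1 expRM_natl exprVn lef_pV2 ?posrE ?exprn_gt0 ?expR_gt0//.
by rewrite lerXn2r ?nnegrE ?expR_ge0// expR1_ge.
Qed.

End exponential_inequalities.

Arguments expRN1_ge R : clear implicits.
Arguments expR1_ge R : clear implicits.

(* With [a = f x], [b = f (x - tau)] and cost [phi (l tau) <= l^2 / 40], the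
   convexity of f bounds the infimum convolution at x by w as below. *)
Section pointwise.
Context {R : realType}.
Implicit Types a b f w : R.

Lemma pointwise_small a b w : 0 <= b <= a -> a <= 10^-1 ->
  (forall l, 0 <= l <= 1 -> w <= (1 - l) * a + l * b + l ^+ 2 / 40) ->
  expR w + expR (- a) + a ^+ 2 / 10 <= 2 + 20 * b ^+ 2.
Proof.
move=> /andP[b0 ba] a1 H.
have ea : expR (- a) <= 1 - a + a ^+ 2 by apply: expRN_le_quadratic; lra.
have [d|d] := leP (a - b) 10^-1; last by lra.
have [d4|d4] := leP (10 * (a - b)) 1; last by lra.
(* The optimum would be [20 (a - b)]; this choice stays in [[0, 1]], as [a - b <= 1/10]. *)
pose l := 10 * (a - b).
have := H l; rewrite /l => /(_ _) Hl.
have {}Hl : w <= a - 15 / 2 * (a - b) ^+ 2.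
  have h : 0 <= 10 * (a - b) <= 1 by lra.
  by have := Hl h; lra.
have w1 : expR w <= expR (a - 15 / 2 * (a - b) ^+ 2) by rewrite ler_expR.
have w2 : expR (a - 15 / 2 * (a - b) ^+ 2) <=
    1 + (a - 15 / 2 * (a - b) ^+ 2) + 9 / 8 * (a - 15 / 2 * (a - b) ^+ 2) ^+ 2.
  by apply: expR_le_quadratic; nra.
have h : 0 <= a - 15 / 2 * (a - b) ^+ 2 <= a by nra.
have h2 : (a - 15 / 2 * (a - b) ^+ 2) ^+ 2 <= a ^+ 2.
  by rewrite ler_pXn2r ?nnegrE//; lra.
have : 0 <= (a - 2 * b) ^+ 2 by exact: sqr_ge0.
have := sqr_ge0 b.
by nra.
Qed.

(** The term [1/1000] stands for [a^2 / 10] with [a] at the truncation level 1/10; the surplus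
    [3/100] is the gain that will pay for the far right. *)
Lemma pointwise_large b w f : 0 <= b <= 10^-1 -> w <= b + 40^-1 -> 10^-1 <= f ->
  expR w + expR (- f) + 1 / 1000 + 3 / 100 <= 2 + 20 * b ^+ 2.
Proof.
move=> b01 wb f1.
have ef : expR (- f) <= 10 / 11.
  apply: (@le_trans _ _ (expR (- 10^-1))); first by rewrite ler_expR; lra.
  apply: le_trans (expR_le_invB _) _; first by lra.
  by rewrite -[(_)^-1]mul1r ler_pdivrMr; lra.
have ew : expR w <= 1 + 8 / 7 * (b + 40^-1).
  apply: (@le_trans _ _ (expR (b + 40^-1))); first by rewrite ler_expR.
  apply: le_trans (expR_le_invB _) _; first by lra.
  by rewrite -[(_)^-1]mul1r ler_pdivrMr; nra.
(* The point [1/35] maximises [8/7 b - 20 b^2]. *)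
have : 0 <= (b - 1 / 35) ^+ 2 by exact: sqr_ge0.
by nra.
Qed.

End pointwise.

(** * Symmetric laws with log-concave tails *)

Section symmetric_measure.
Context {R : realType} (mu : probability (measurableTypeR R) R).
Local Notation T := (measurableTypeR R).

Definition mgf (y : R) : \bar R := (\int[mu]_x (expR (y * x))%:E)%E.

(* [rate_le x r] means [Lambda^* x <= r]. *)
Definition rate_le (x r : R) := forall y, ((expR (x * y - r))%:E <= mgf y)%E.

Definition tail (t : R) : R := fine (mu [set x | t <= `|x|]).

Definition rtail (t : R) : R := fine (mu `[t, +oo[%classic).

Lemma measurable_expRM (y : R) (D : set T) :
  measurable_fun D (fun x : T => (expR (y * x))%:E).
Proof.
apply/measurable_EFinP; apply: measurable_funTS.
apply: measurableT_comp => //; exact: mulrl_measurable.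
Qed.

Lemma measurable_abs_ge (t : R) : measurable [set x : T | t <= `|x|].
Proof.
have -> : [set x : T | t <= `|x|] = (fun x : T => `|x|) @^-1` `[t, +oo[%classic.
  by apply/seteqP; split=> x /=; rewrite in_itv/= andbT.
rewrite -[X in measurable X]setTI; apply: normr_measurable => //.
Qed.

Lemma rtailE t : mu `[t, +oo[%classic = (rtail t)%:E.
Proof. by rewrite fineK// fin_num_measure//; exact: measurable_itv. Qed.

Lemma tailE t : mu [set x | t <= `|x|] = (tail t)%:E.
Proof. by rewrite fineK// fin_num_measure//; exact: measurable_abs_ge. Qed.

Lemma rtail_ge0 t : 0 <= rtail t. Proof. by rewrite -lee_fin -rtailE. Qed.

Lemma rtail_le1 t : rtail t <= 1.
Proof. by rewrite -lee_fin -rtailE probability_le1//; exact: measurable_itv. Qed.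

Lemma tail_ge0 t : 0 <= tail t. Proof. by rewrite -lee_fin -tailE. Qed.

Lemma tail_le1 t : tail t <= 1.
Proof. by rewrite -lee_fin -tailE probability_le1//; exact: measurable_abs_ge. Qed.

Lemma rtail_anti s t : s <= t -> rtail t <= rtail s.
Proof.
move=> st; rewrite -lee_fin -!rtailE le_measure ?inE//; try exact: measurable_itv.
by move=> x /=; rewrite !in_itv/= !andbT; exact: le_trans.
Qed.

Lemma tail_anti s t : s <= t -> tail t <= tail s.
Proof.
move=> st; rewrite -lee_fin -!tailE le_measure ?inE//; try exact: measurable_abs_ge.
by move=> x /=; exact: le_trans.
Qed.

Lemma tail0 : tail 0 = 1.
Proof.
rewrite /tail (_ : [set x | _] = setT) ?probability_setT//.
by apply/seteqP; split => x //= _; exact: normr_ge0.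
Qed.

Definition symmetric_measure := forall A : set T, measurable A ->
  mu A = mu (-%R @^-1` A).

Hypothesis sym : symmetric_measure.

Lemma symmetric_integral (g : T -> \bar R) : measurable_fun setT g ->
  (forall x, (0 <= g x)%E) -> (\int[mu]_x g (- x)%R = \int[mu]_x g x)%E.
Proof.
move=> mg g0.
have mN : measurable_fun [set: T] (-%R : T -> T) by exact: oppr_measurable.
have := @ge0_integral_pushforward _ _ T T R (-%R : T -> T) mN mu setT g measurableT mg.
rewrite preimage_setT => <-; last by move=> *; exact: g0.
apply: eq_measure_integral => A mA _.
by rewrite /pushforward [RHS]sym.
Qed.

Lemma mgfN y : mgf (- y) = mgf y.
Proof.
rewrite /mgf -[RHS]symmetric_integral//; last first.
  exact: measurable_expRM.
by apply: eq_integral => x _; rewrite mulrN mulNr.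
Qed.

(** Symmetry takes the place of Jensen's inequality: [mgf y] and [mgf (- y)] are equal, and
    [e^z + e^(-z) >= 2]. *)
Lemma mgf_ge1 y : (1 <= mgf y)%E.
Proof.
have H : ((2 : R)%:E <= mgf y + mgf (- y))%E.
  rewrite /mgf -ge0_integralD//; try exact: measurable_expRM.
  have -> : ((2 : R)%:E = \int[mu]_x (cst (2 : R)%:E x))%E.
    by rewrite integral_cst//= probability_setT mule1.
  apply: ge0_le_integral => //.
  - by move=> x _ /=; rewrite lee_fin.
  - apply: emeasurable_funD; exact: measurable_expRM.
  - move=> x _ /=; rewrite -EFinD lee_fin.
    by have := expR_ge1Dx (y * x); have := expR_ge1Dx (- y * x); rewrite mulNr; lra.
move: H; rewrite mgfN; case: (mgf y) => [r| |]//=.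
  by rewrite -EFinD !lee_fin; lra.
by move=> _; rewrite leey.
Qed.

Lemma mgf0 : mgf 0 = 1%E.
Proof.
rewrite /mgf; under eq_integral do rewrite mul0r expR0.
by rewrite integral_cst//= probability_setT mule1.
Qed.

Lemma tail_rtail t : 0 < t -> tail t = 2 * rtail t.
Proof.
move=> t0; apply/EFin_inj; rewrite -tailE.
pose B : set T := -%R @^-1` (`[t, +oo[%classic : set T).
have mB : measurable B.
  by rewrite -[X in measurable X]setTI; apply: oppr_measurable => //; exact: measurable_itv.
have muB : mu B = (rtail t)%:E by rewrite -rtailE -sym.
have -> : [set x : T | t <= `|x|] = `[t, +oo[%classic `|` B.
  apply/seteqP; split => x /=; rewrite /B/= !in_itv/= !andbT.
    by move=> h; apply/orP; rewrite -ler_normr.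
  by move=> h; rewrite ler_normr; apply/orP.
rewrite measureU//; last first.
  by apply/seteqP; split => x //=; rewrite /B/= !in_itv/= !andbT => -[]; lra.
have -> : (2 * rtail t)%:E = ((rtail t)%:E + (rtail t)%:E)%E.
  by rewrite -EFinD; congr EFin; ring.
by rewrite -{1}rtailE -muB.
Qed.

Lemma rtail0_ge : 2^-1 <= rtail 0.
Proof.
have mN : measurable (-%R @^-1` (`[0, +oo[%classic : set T)).
  rewrite -[X in measurable X]setTI; apply: oppr_measurable => //; exact: measurable_itv.
have : (mu setT <= mu `[0%R, +oo[%classic + mu (-%R @^-1` `[0%R, +oo[%classic))%E.
  have -> : [set: T] = `[0, +oo[%classic `|` (-%R @^-1` `[0, +oo[%classic).
    apply/seteqP; split => x //= _; rewrite !in_itv/= !andbT.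
    by have [|] := leP 0 x; [left|right; lra].
  by apply: measureU2 => //; exact: measurable_itv.
rewrite -sym ?rtailE ?probability_setT -?EFinD ?lee_fin; last exact: measurable_itv.
lra.
Qed.

Lemma rtail_half t : t <= 0 -> 2^-1 <= rtail t.
Proof. by move=> t0; apply: le_trans rtail0_ge (rtail_anti t0). Qed.

Lemma rate_le_ge0 x r : rate_le x r -> 0 <= r.
Proof.
by move=> /(_ 0); rewrite mgf0 mulr0 sub0r lee_fin expR_le1 oppr_le0.
Qed.

Lemma rate_le0 : rate_le 0 0.
Proof. by move=> y; rewrite mul0r subr0 expR0 mgf_ge1. Qed.

Lemma rate_le_conv l x r x' r' : 0 <= l <= 1 -> rate_le x r -> rate_le x' r' ->
  rate_le (l * x + (1 - l) * x') (l * r + (1 - l) * r').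
Proof.
move=> l01 H H' y; have := H y; have := H' y => h' h.
have [le|le] := leP (x * y - r) (x' * y - r').
  by apply: le_trans h'; rewrite lee_fin ler_expR; nra.
by apply: le_trans h; rewrite lee_fin ler_expR; nra.
Qed.

Lemma rate_leN x r : rate_le x r -> rate_le (- x) r.
Proof. by move=> H y; rewrite -mgfN mulNr -mulrN. Qed.

Lemma rate_leW x r s : r <= s -> rate_le x r -> rate_le x s.
Proof.
move=> rs H y; apply: le_trans (H y); rewrite lee_fin ler_expR; lra.
Qed.

Lemma rate_le_scale l x r : 0 <= l <= 1 -> rate_le x r -> rate_le (l * x) (l * r).
Proof.
move=> l01 H; have := rate_le_conv l01 H rate_le0.
by rewrite !mulr0 !addr0.
Qed.

(** The point [x'] is a convex combination of [|x|] and [- |x|], where the rates agree by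
    symmetry. *)
Lemma rate_le_mono x x' r : `|x'| <= `|x| -> rate_le x r -> rate_le x' r.
Proof.
move=> xx H.
have [x0|x0] := eqVneq x 0.
  move: xx; rewrite x0 normr0 normr_le0 => /eqP->.
  by apply: rate_leW rate_le0; exact: rate_le_ge0 H.
have xp : 0 < `|x| by rewrite normr_gt0.
have H1 : rate_le `|x| r.
  have [x1|x1] := leP 0 x; [by rewrite ger0_norm|rewrite ltr0_norm//; exact: rate_leN].
have := @rate_le_conv ((1 + x' / `|x|) / 2) _ _ _ _ _ H1 (rate_leN H1).
have : `|x' / `|x| | <= 1.
  by rewrite normrM normfV normr_id ler_pdivrMr// mul1r.
rewrite ler_norml => h /(_ _).
have -> : (1 + x' / `|x|) / 2 * `|x| + (1 - (1 + x' / `|x|) / 2) * - `|x| = x'.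
  by field; rewrite gt_eqF.
have -> : (1 + x' / `|x|) / 2 * r + (1 - (1 + x' / `|x|) / 2) * r = r.
  by field; rewrite gt_eqF.
by apply; lra.
Qed.

Lemma convex_cost_rate b : convex_cost (fun h : R^o => rate_le (b * h)).
Proof.
split.
- by move=> h r; exact: rate_le_ge0.
- by rewrite mulr0; exact: rate_le0.
move=> l h r h' r' l01 H H'.
have := rate_le_conv l01 H H'; rewrite /GRing.scale/=.
by rewrite mulrDr !mulrA ![b * _]mulrC.
Qed.

(* Chernoff's bound, read backwards: an upper bound on the rate. *)
Lemma rate_le_chernoff s : 0 < s -> 0 < tail s -> rate_le s (ln 2 - ln (tail s)).
Proof.
move=> s0 S0 y.
have -> : expR (s * y - (ln 2 - ln (tail s))) = expR (s * y) * rtail s.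
  rewrite expRD opprB expRB !lnK ?posrE ?ltr0n//.
  by rewrite tail_rtail//; field.
have [y0|y0] := leP 0 y.
  rewrite EFinM -rtailE -integral_cst//.
  apply: (@le_trans _ _ (\int[mu]_(x in `[s, +oo[%classic) (expR (y * x))%:E)%E).
    apply: ge0_le_integral => //; last 2 first.
      exact: measurable_expRM.
      by move=> x /=; rewrite in_itv/= andbT => sx; rewrite lee_fin ler_expR; nra.
    by move=> *; rewrite lee_fin expR_ge0.
  apply: ge0_subset_integral => //; try exact: measurable_itv.
  exact: measurable_expRM.
apply: le_trans (mgf_ge1 y); rewrite lee_fin.
have : expR (s * y) <= 1 by rewrite expR_le1; nra.
by have := rtail_ge0 s; have := rtail_le1 s; have := expR_gt0 (s * y); nra.
Qed.

(** Where [|X| >= u] one has [cosh (y X) >= cosh (u y)], and [cosh >= 1] elsewhere. The moment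
    generating function thus dominates that of the law with mass [p] split between [u] and [- u] and
    the rest at 0, whose rate is bounded by [expR_le_mixture_cosh]. *)
Lemma rate_le_quadratic u p x : 0 < u -> 0 < p <= tail u -> `|x| <= p * u ->
  rate_le x ((x / u) ^+ 2 / p).
Proof.
move=> u0 /andP[p0 pS] xp y.
have p1 : p <= 1 by apply: le_trans pS (tail_le1 _).
have q1 : `|x / u| <= p by rewrite normrM normfV (gtr0_norm u0) ler_pdivrMr.
have := expR_le_mixture_cosh (u * y) (introT andP (conj p0 p1)) q1.
have -> : x / u * (u * y) = x * y by field; rewrite gt_eqF.
move=> h; apply: (@le_trans _ _ (1 + p * ((expR (u * y) + expR (- (u * y))) / 2 - 1))%:E).
  by rewrite lee_fin.
set c := (_ / 2 - 1).
have c0 : 0 <= c.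
  by rewrite /c; have := expR_ge1Dx (u * y); have := expR_ge1Dx (- (u * y)); lra.
pose A : set T := [set z | u <= `|z|].
have mA : measurable A := measurable_abs_ge u.
have E2 : ((2 * c)%:E * mu A = (2 * c * tail u)%:E)%E by rewrite tailE EFinM.
have mI : measurable_fun setT (fun z : T => (\1_A z : R)%:E).
  by apply/measurable_EFinP; exact: measurable_indic.
have : ((2 : R)%:E + (2 * c * tail u)%:E <= mgf y + mgf (- y))%E.
  rewrite /mgf -ge0_integralD//; try exact: measurable_expRM.
  have <- : (\int[mu]_z ((2 : R)%:E + (2 * c)%:E * (\1_A z : R)%:E) = (2 : R)%:E + (2 * c * tail u)%:E)%E.
    rewrite ge0_integralD//=; last 2 first.
    - by move=> z _; rewrite mule_ge0// lee_fin mulr_ge0.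
    - exact: measurable_funeM.
    rewrite integral_cst//= probability_setT mule1 ge0_integralZl_EFin//=.
      rewrite integral_indic// setIT.
      exact: congr1 E2.
    by rewrite mulr_ge0.
  apply: ge0_le_integral => //=.
  - by move=> z _; rewrite adde_ge0 ?mule_ge0 ?lee_fin ?mulr_ge0.
  - by apply: emeasurable_funD => //; exact: measurable_funeM.
  - apply: emeasurable_funD; exact: measurable_expRM.
  move=> z _; rewrite -EFinM -!EFinD lee_fin mulNr indicE.
  have h1 := expR_ge1Dx (y * z); have h2 := expR_ge1Dx (- (y * z)).
  have [zA|_] := boolP (z \in A); last by rewrite mulr0; lra.
  rewrite mulr1 /c mulrBr mulrCA mulfV ?pnatr_eq0// !mulr1 addrC subrK.
  (* cosh is even and nondecreasing on the positive half-line *)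
  move: zA; rewrite inE /A/= => uz.
  have cs (v w : R) : `|v| <= `|w| -> expR v + expR (- v) <= expR w + expR (- w).
    move=> vw.
    have abs (t : R) : expR t + expR (- t) = expR `|t| + expR (- `|t|).
      by have [t0|t0] := leP 0 t; rewrite ?(ger0_norm t0)// (ltr0_norm t0) opprK addrC.
    rewrite (abs v) (abs w) !expRN.
    have e1 : 1 <= expR `|v| by have := expR_ge1Dx `|v|; have := normr_ge0 v; lra.
    have e2 : expR `|v| <= expR `|w| by rewrite ler_expR.
    rewrite -subr_ge0.
    set a := expR `|v| in e1 e2 *; set b := expR `|w| in e2 *.
    have -> : b + b^-1 - (a + a^-1) = (b - a) * (1 - (a * b)^-1).
      by field; apply/andP; split; lra.
    rewrite mulr_ge0 ?subr_ge0// invf_le1; nra.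
  apply: cs; rewrite !normrM (gtr0_norm u0) mulrC.
  by rewrite ler_wpM2l.
rewrite mgfN; case: (mgf y) => [m| |]//=; last by move=> _; rewrite leey.
rewrite -!EFinD !lee_fin; nra.
Qed.

End symmetric_measure.

Section block_integral.
Context {R : realType} (mu : probability (measurableTypeR R) R).
Local Notation T := (measurableTypeR R).

Lemma integral_le_cst (D : set T) (g : T -> \bar R) c : measurable D ->
  measurable_fun D g -> (forall x, D x -> (0 <= g x <= c)%E) ->
  (\int[mu]_(x in D) g x <= c * mu D)%E.
Proof.
move=> mD mg gc; rewrite -integral_cst//; apply: ge0_le_integral => //.
- by move=> x /gc/andP[].
- by move=> x /gc/andP[].
Qed.

(** The half-line is cut into blocks of length [r], on which an exponential is comparable to a
    constant; the weights [1 / 2^(j+1)] sum to 1. *)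
Lemma block_integral_le (s r : R) (g : T -> \bar R) (C : R) : 0 < r -> 0 <= C ->
  measurable_fun setT g -> (forall x, (0 <= g x)%E) ->
  (forall j : nat, (\int[mu]_(x in `[(s + j%:R * r)%R, (s + j%:R * r + r)%R[) g x <=
     (C / (2 ^ j.+1)%:R)%:E)%E) ->
  (\int[mu]_(x in `[s, +oo[) g x <= C%:E)%E.
Proof.
move=> r0 C0 mg g0 H.
pose F (j : nat) : set T := `[s + j%:R * r, (s + j%:R * r) + r[%classic.
have -> : `[s, +oo[%classic = \bigcup_j F j.
  apply/seteqP; split => x /=; last first.
    move=> [j _]; rewrite /F/= !in_itv/= andbT => /andP[h _].
    by apply: le_trans h; rewrite lerDl mulr_ge0// ltW.
  rewrite in_itv/= andbT => sx.
  have h0 : 0 <= (x - s) / r by rewrite divr_ge0 ?subr_ge0// ltW.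
  exists (Num.truncn ((x - s) / r)) => //; rewrite /F/= in_itv/=.
  have /andP[] := truncn_itv h0.
  set k := Num.truncn _; rewrite ler_pdivlMr// ltr_pdivrMr// -natr1 mulrDl mul1r.
  by move=> h1 h2; apply/andP; split; lra.
rewrite ge0_integral_bigcup//; last 3 first.
- by move=> j; exact: measurable_itv.
- exact: measurable_funTS.
- move=> i j _ _ [x []]; rewrite /F/= !in_itv/= => /andP[i1 i2] /andP[j1 j2].
  have key (a b : nat) : a%:R * r < b%:R * r + r -> (a <= b)%N.
    by rewrite -{3}[r]mul1r -mulrDl ltr_pM2r// natr1 ltr_nat ltnS.
  by apply/eqP; rewrite eqn_leq; apply/andP; split; apply: key; lra.
apply: le_trans (epsilon_trick0 xpredT C0).
by apply: lee_nneseries => [i _ _|i _]; [exact: integral_ge0|exact: H].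
Qed.

End block_integral.

(** * Tails and costs at the scale w *)

Section log_concave_scale.
Context {R : realType} (mu : probability (measurableTypeR R) R).
Local Notation T := (measurableTypeR R).
Local Notation tail := (tail mu).
Local Notation rtail := (rtail mu).
Hypothesis sym : symmetric_measure mu.

(* log-concavity of the tail between 0 and t; star-shapedness of -ln tail is
   all that the argument needs *)
Definition star_tail := forall t l, 0 <= t -> 0 <= l <= 1 -> 0 < tail t ->
  expR (l * ln (tail t)) <= tail (l * t).

Hypothesis star : star_tail.

(** Both [s] and [t] are fractions of [s + t]: the star-shaped function [- ln tail] is
    superadditive. *)
Lemma tail_mul s t : 0 <= s -> 0 <= t -> tail (s + t) <= tail s * tail t.
Proof.
move=> s0 t0; have [S0|S0] := ltP 0 (tail (s + t)); last first.
  by apply: le_trans S0 _; rewrite mulr_ge0// tail_ge0.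
have [st0|st0] := eqVneq (s + t) 0.
  have -> : s = 0 by lra.
  have -> : t = 0 by lra.
  by rewrite addr0 tail0 mulr1.
have st1 : 0 < s + t by rewrite lt_neqAle eq_sym st0 addr_ge0.
have h (x : R) : 0 <= x <= s + t -> expR (x / (s + t) * ln (tail (s + t))) <= tail x.
  move=> x01; have := @star (s + t) (x / (s + t)) (ltW st1).
  rewrite (_ : x / (s + t) * (s + t) = x); last by field.
  apply => //; rewrite divr_ge0 ?ler_pdivrMr ?mul1r//; lra.
have hs : 0 <= s <= s + t by lra.
have ht : 0 <= t <= s + t by lra.
have -> : tail (s + t) = expR (s / (s + t) * ln (tail (s + t))) *
    expR (t / (s + t) * ln (tail (s + t))).
  by rewrite -expRD -mulrDl -mulrDl mulfV// mul1r lnK.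
by apply: ler_pM; rewrite ?expR_ge0//; exact: h.
Qed.

(** As [s] may be negative, only half of the shift is kept in the tail: for [s <= 0] the point
    [s + y] still lies beyond [y / 2], and [rtail s >= 1/2]. *)
Lemma rtail_shift a s y : 0 <= a -> 0 < y -> 2 * a <= y -> - a <= s ->
  rtail (s + y) <= tail (y / 2) * rtail s.
Proof.
move=> a0 y0 ay sa.
have r0 := rtail_ge0 mu s; have r1 := rtail_le1 mu s.
have [s0|s0] := ltP 0 s.
  have := tail_mul (ltW s0) (ltW y0).
  have : tail y <= tail (y / 2) by apply: tail_anti; lra.
  have := tail_rtail sym s0; have := @tail_rtail _ _ sym (s + y); have := tail_ge0 mu s.
  by move=> h1 /(_ _) h2 h3; rewrite h2 ?h3; [nra|lra].
have h : rtail (s + y) = tail (s + y) / 2.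
  by rewrite (@tail_rtail _ _ sym (s + y)); [field|lra].
have : tail (s + y) <= tail (y / 2) by apply: tail_anti; lra.
have := rtail_half sym s0; have := tail_ge0 mu (y / 2).
by rewrite h; nra.
Qed.

Variable w : R.
Hypotheses (w0 : 0 < w) (tail_w : tail w <= expR (-1)) (tail_u : expR (-1) <= tail (w / 4)).

(** At the fraction [w / s] of [s], star-shapedness reads
    [(w / s) ln (tail s) <= ln (tail w) <= -1]. *)
Lemma tail_exp s : w <= s -> tail s <= expR (- (s / w)).
Proof.
move=> ws; have [S0|S0] := ltP 0 (tail s); last exact: le_trans S0 (expR_ge0 _).
have s0 : 0 < s := lt_le_trans w0 ws.
have := @star s (w / s) (ltW s0).
rewrite divr_ge0 ?(ltW s0) ?(ltW w0)//= ler_pdivrMr// mul1r => /(_ ws S0).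
rewrite divfK ?gt_eqF// => /le_trans/(_ tail_w).
rewrite ler_expR => h.
rewrite -[X in X <= _]lnK// ler_expR.
move: h; rewrite mulrAC ler_pdivrMr// mulN1r => h.
by rewrite -mulNr ler_pdivlMr// mulrC.
Qed.

(* [60 * 56 = 1680 * 2 <= 1680 * e] *)
Variable beta : R.
Hypothesis betaE : beta = 60 * 56.

Let beta0 : 0 < beta. Proof. by rewrite betaE; lra. Qed.

Definition cost (h r : R) := rate_le mu (beta^-1 * h) r.

(** The quadratic bound at [u = w / 4] with [p = 1/4], allowed by [tail (w / 4) >= 1/e >= 1/4]. It
    is valid up to [|h| = beta w / 16 = 210 w], and [20 * 21 = beta / 8]. *)
Lemma cost_quadratic h : `|h| <= 128 * w -> cost h ((h / (20 * 21 * w)) ^+ 2).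
Proof.
move=> hw; have w4 : 0 < w / 4 by rewrite divr_gt0.
have p4 : 0 < (4^-1 : R) <= tail (w / 4).
  by rewrite (le_trans (expRN1_ge R) tail_u) andbT invr_gt0.
have bw : `|beta^-1 * h| <= 4^-1 * (w / 4).
  rewrite mulrC normrM normfV (gtr0_norm beta0) ler_pdivrMr// betaE; have := w0; lra.
have := @rate_le_quadratic _ _ sym (w / 4) (4^-1 : R) (beta^-1 * h) w4 p4 bw.
rewrite /cost.
have -> : (beta^-1 * h / (w / 4)) ^+ 2 / 4^-1 = (h / (20 * 21 * w)) ^+ 2.
  by rewrite betaE; field; rewrite gt_eqF.
by [].
Qed.

Lemma cost_mono h h' r : `|h'| <= `|h| -> cost h r -> cost h' r.
Proof.
by move=> hh; apply: rate_le_mono => //; rewrite !normrM ler_wpM2l.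
Qed.

(** A convex rate vanishing at 0 costs at most the fraction [t] of Chernoff's bound at [t s]. This
    is where a large [beta] pays: a jump as long as [beta t s] is bought for that fraction. *)
Lemma cost_chernoff s t h : 0 < s -> 0 < tail s -> 0 <= t <= 1 ->
  `|h| <= beta * (t * s) -> cost h (t * (ln 2 - ln (tail s))).
Proof.
move=> s0 S0 t01 hs.
have := rate_le_scale sym t01 (rate_le_chernoff sym s0 S0).
apply: rate_le_mono => //.
have ts : 0 <= t * s by case/andP: t01 => t0 _; rewrite mulr_ge0// ltW.
by rewrite mulrC normrM normfV (gtr0_norm beta0) (ger0_norm ts) ler_pdivrMr// mulrC.
Qed.

(** With [s = (j + 1) y / 2], the block at distances [(j + 1) y] to [(j + 2) y] from [L] has mass at
    most [tail s * rtail L], while a jump of twice these distances costs at most a quarter of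
    [ln 2 - ln (tail s)]. Its contribution is at most [2^(1/4) (tail s)^(3/4) rtail L], and
    [tail s <= e^(-16 (j + 1))] because [y >= 32 w]. *)
Lemma tail_integral L y (g : T -> \bar R) : 32 * w <= y ->
  (forall z, y <= z -> rtail (L + z) <= tail (z / 2) * rtail L) ->
  measurable_fun setT g -> (forall x, (0 <= g x)%E) ->
  (forall x r, L + y <= x -> cost (2 * (x - L)) r -> (g x <= (expR r)%:E)%E) ->
  (\int[mu]_(x in `[(L + y)%R, +oo[) g x <= (100^-1 * rtail L)%:E)%E.
Proof.
move=> wy Hy mg g0 gr.
have y0 : 0 < y by apply: lt_le_trans wy; rewrite mulr_gt0.
have rL0 := rtail_ge0 mu L.
apply: (@block_integral_le _ _ _ y) => // [|j]; first by rewrite mulr_ge0// invr_ge0.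
set B := `[_, _[%classic.
have mB : measurable B by exact: measurable_itv.
pose s := j.+1%:R * y / 2.
have j0 : 0 <= j%:R :> R by exact: ler0n.
have js : j.+1%:R = j%:R + 1 :> R by rewrite natr1.
have jy : 0 <= j%:R * (y - 32 * w) by rewrite mulr_ge0// subr_ge0.
have jw : 0 <= j%:R * w by rewrite mulr_ge0// ltW.
have w1 := w0.
have s0 : 0 < s by rewrite /s divr_gt0// mulr_gt0.
have muB : (mu B <= (tail s * rtail L)%:E)%E.
  apply: (@le_trans _ _ (rtail (L + j.+1%:R * y))%:E).
    rewrite -rtailE le_measure ?inE//.
    by move=> x; rewrite /B/= !in_itv/= andbT js => /andP[+ _]; rewrite mulrDl mul1r; lra.
  by rewrite lee_fin; apply: Hy; rewrite js mulrDl mul1r lerDr mulr_ge0// ltW.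
(* Where the tail vanishes Chernoff gives no bound on the cost, but the block is null. *)
have [S0|S0] := ltP 0 (tail s); last first.
  rewrite null_set_integral//; first by rewrite lee_fin divr_ge0// mulr_ge0// invr_ge0.
    exact: measurable_funTS.
  apply/eqP; rewrite eq_le measure_ge0 andbT; apply: le_trans muB _.
  by rewrite lee_fin mulr_le0_ge0.
pose r := 4^-1 * (ln 2 - ln (tail s)).
apply: (@le_trans _ _ ((expR r)%:E * mu B)%E).
  apply: integral_le_cst => //; first exact: measurable_funTS.
  move=> x; rewrite /B/= in_itv/= => /andP[x1 x2]; rewrite g0/=.
  have x3 : L + y <= x by apply: le_trans x1; rewrite lerDl mulr_ge0// ltW.
  apply: gr => //; apply: cost_chernoff => //; first lra.
  rewrite betaE.
  by rewrite ger0_norm /s ?js; lra.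
apply: (@le_trans _ _ ((expR r)%:E * (tail s * rtail L)%:E)%E).
  by rewrite lee_pmul2l// lte_fin expR_gt0.
rewrite -EFinM lee_fin mulrA [_ / _]mulrAC ler_wpM2r//.
have sw : 16 * j.+1%:R <= s / w by rewrite ler_pdivlMr// /s js; lra.
have S1 : ln (tail s) <= - (s / w).
  rewrite -ler_expR lnK//; apply: tail_exp; rewrite /s js; lra.
have l2 : ln 2 <= 1 :> R.
  by rewrite -ler_expR lnK ?posrE//; have := expR_ge1Dx (1 : R); lra.
have -> : expR r * tail s = expR (4^-1 * ln 2 + 3 / 4 * ln (tail s)).
  by rewrite -[X in _ * X]lnK// -expRD; congr expR; rewrite /r; field.
apply: (@le_trans _ _ (expR (- (7 + j.+1)%:R))).
  by rewrite ler_expR natrD js; rewrite js in sw; lra.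
have posn : 0 < 100 * (2 ^ j.+1)%:R :> R by rewrite mulr_gt0// ltr0n expn_gt0.
rewrite expRN -[X in expR X]mulr1 expRM_natl exprD -invfM lef_pV2 ?posrE//.
have e2 : 2 <= expR 1 :> R by have := expR_ge1Dx (1 : R); lra.
apply: ler_pM => //; last by rewrite natrX lerXn2r ?nnegrE ?expR_ge0.
apply: (@le_trans _ _ (2 ^+ 7)); first by lra.
by rewrite lerXn2r ?nnegrE ?expR_ge0.
Qed.

End log_concave_scale.

(** * Integrals of translated monotone functions *)

Section monotone_shift.
Context {R : realType} (mu : probability (measurableTypeR R) R).
Local Notation T := (measurableTypeR R).
Local Notation rtail := (rtail mu).
Variables (a tau rho : R).
Hypothesis rho0 : 0 <= rho.
Hypothesis shift : forall s, - a <= s -> rtail (s + tau) <= rho * rtail s.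

(** An up-set is a half-line, open or closed, whereas [shift] speaks of closed ones: [U] is
    exhausted by half-lines [[v n, +oo[], where [v n] is the infimum if it belongs to [U] and
    decreases to it otherwise. *)
Lemma upset_shift (U : set T) : measurable U ->
  (forall x y : R, U x -> x <= y -> U y) -> (forall x : R, U x -> - a <= x) ->
  (mu [set x : T | U (x - tau)%R] <= rho%:E * mu U)%E.
Proof.
move=> mU Uup Ua.
have [->|/set0P[x0 Ux0]] := eqVneq U set0.
  by rewrite (_ : [set x : T | set0 (x - tau)%R] = set0) ?measure0 ?mule0//.
pose s : R := inf (U : set R).
have hasU : has_inf (U : set R).
  by split; [exists x0|exists (- a) => x /Ua].
pose v (n : nat) : R := if `[< U s >] then s else s + n.+1%:R^-1.
have vU n : U (v n).
  rewrite /v; case: asboolP => // _.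
  have := @inf_adherent _ (U : set R) n.+1%:R^-1.
  rewrite invr_gt0 ltr0n => /(_ isT hasU)[y Uy ys].
  by apply: Uup Uy _; apply: ltW.
have vcov (x : R) : U x -> exists n, v n <= x.
  move=> Ux; rewrite /v; case: asboolP => [Us|nUs].
    by exists 0%N; apply: ge_inf => //; exact: hasU.2.
  have sx : s < x.
    rewrite lt_neqAle ge_inf ?andbT//; last exact: hasU.2.
    by apply/eqP => sx; apply: nUs; rewrite sx.
  have [n hn] := ltr_add_invr sx.
  by exists n; exact: ltW.
pose F n : set T := `[v n + tau, +oo[%classic.
have -> : [set x : T | U (x - tau)%R] = \bigcup_n F n.
  apply/seteqP; split => x /=.
    move=> /vcov[n vn]; exists n => //; rewrite /F/= in_itv/= andbT; lra.
  move=> [n _]; rewrite /F/= in_itv/= andbT => h.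
  by apply: Uup (vU n) _; lra.
have mF n : measurable (F n) by exact: measurable_itv.
have cv : (mu \o F) x @[x --> \oo] --> mu (\bigcup_n F n).
  apply: nondecreasing_cvg_mu => //; first exact: bigcup_measurable.
  move=> n m nm; rewrite subsetEset => x; rewrite /F/= !in_itv/= !andbT.
  apply: le_trans; rewrite lerD2r /v; case: asboolP => // _.
  by rewrite lerD2l lef_pV2 ?posrE ?ltr0n// ler_nat.
rewrite -(cvg_lim _ cv)//; apply: lime_le; first by apply/cvg_ex; eexists; exact: cv.
apply: nearW => n /=; rewrite rtailE.
apply: (@le_trans _ _ (rho%:E * (rtail (v n))%:E)%E).
  by rewrite -EFinM lee_fin; apply: shift; apply: Ua.
rewrite lee_pmul// ?lee_fin ?rtail_ge0// -rtailE le_measure ?inE//.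
by move=> x /=; rewrite in_itv/= andbT; apply: Uup.
Qed.

(** Layer-cake formula: the sets [g > r] with [r >= 0] are up-sets contained in [[- a, +oo[]. *)
Lemma integral_shift_le (g : R -> R) : (forall x, 0 <= g x) ->
  {homo g : x y / x <= y} -> (forall x, x <= - a -> g x = 0) ->
  (\int[mu]_x (g (x - tau))%:E <= rho%:E * \int[mu]_x (g x)%:E)%E.
Proof.
move=> g0 gmon ga.
have mg : measurable_fun [set: T] (g : T -> R) by exact: nondecreasing_measurable.
have mh : measurable_fun [set: T] ((fun x => g (x - tau)) : T -> R).
  by apply: nondecreasing_measurable => // x y xy; apply: gmon; lra.
have mU r : measurable ([set x : R | r < g x] : set T).
  have -> : [set x : R | r < g x] = g @^-1` `]r, +oo[.
    by apply/seteqP; split => x /=; rewrite in_itv/= andbT.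
  by rewrite -[X in measurable X]setTI; apply: mg => //; exact: measurable_itv.
pose X : {RV mu >-> R} := @mfun_Sub _ _ T _ g (mem_set mg).
pose Y : {RV mu >-> R} := @mfun_Sub _ _ T _ (fun x : R => g (x - tau)) (mem_set mh).
have EX : (\int[mu]_x (g x)%:E = 'E_mu[X])%E by rewrite unlock.
have EY : (\int[mu]_x (g (x - tau)%R)%:E = 'E_mu[Y])%E by rewrite unlock.
rewrite EX EY !ge0_expectation_ccdf//; last by move=> x; exact: g0.
rewrite -ge0_integralZl_EFin//; last first.
  by apply: measurable_funTS; exact: ccdf_measurable.
apply: ge0_le_integral => //.
- by apply: measurable_funTS; exact: ccdf_measurable.
- by apply: measurable_funeM; apply: measurable_funTS; exact: ccdf_measurable.
move=> r; rewrite /= in_itv/= andbT => r0.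
rewrite /ccdf /distribution /pushforward/=.
pose U : set T := [set x | r < g x].
have -> : g @^-1` `]r, +oo[ = U.
  by apply/seteqP; split => x /=; rewrite in_itv/= andbT.
have -> : (fun x => g (x - tau)) @^-1` `]r, +oo[ = [set x : T | U (x - tau)%R].
  by apply/seteqP; split => x /=; rewrite in_itv/= andbT.
apply: upset_shift.
- exact: mU.
- by move=> x y; rewrite /U/= => h xy; apply: lt_le_trans h (gmon _ _ xy).
- move=> x; rewrite /U/= => h; rewrite leNgt; apply/negP => xa.
  by move: h; rewrite ga ?ltW// ltNge r0.
Qed.

End monotone_shift.

Section measurability.
Context {R : realType}.

Lemma measurable_fun_lt d (U : measurableType d) (g : U -> R) :
  (forall t, measurable [set x | g x < t]) -> measurable_fun setT g.
Proof.
move=> H; apply: (measurability _ (RGenInftyO.measurableE R)).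
move=> _ [_ [t ->] <-]; rewrite setTI.
have -> : g @^-1` `]-oo, t[ = [set x | g x < t]; last exact: H.
by apply/seteqP; split => x /=; rewrite in_itv.
Qed.

(** An infimum of continuous functions, however many, is upper semicontinuous: its strict sublevel
    sets are open. *)
Lemma measurable_infc_R (C : R^o -> R -> Prop) (f : R -> R) : convex_cost C ->
  (exists m, forall x, m <= f x) -> cvx (f : R^o -> R) ->
  measurable_fun [set: measurableTypeR R] (infc C (f : R^o -> R) : R -> R).
Proof.
move=> cC fb cf; apply: measurable_fun_lt => t.
have -> : [set x : R | infc C (f : R^o -> R) x < t] =
    \bigcup_(p in [set p : R^o * R | C p.1 p.2])
      ((fun x : R => f (x - p.1)) @^-1` [set y | y < t - p.2]).
  apply/seteqP; split => x /=.
    by move=> /(infc_lt cC fb)[h [r [hr hx]]]; exists (h, r) => //=; lra.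
  move=> [[h r] /= hr hx]; apply: le_lt_trans (infc_le cC fb x hr) _.
  by move: hx; rewrite ltrBrDr.
apply: open_measurable; apply: bigcup_open => -[h r] _ /=.
apply: open_comp => [x _|]; last exact: open_lt.
apply: (@cvx_real_continuous _ (fun x => f (x - h))) => l y z l01.
have := cf l (y - h) (z - h) l01; rewrite /GRing.scale/=.
by have -> : l * (y - h) + (1 - l) * (z - h) = l * y + (1 - l) * z - h by ring.
Qed.

End measurability.

(** * Small slopes *)

(** The final count, with [a], [b] the integrals of the two squares, [j] and [k] the gain and the
    loss on the right, [l] the loss on the left and [t] the squared slope. Here [20 b <= a / 20]
    leaves [a / 20 >= t / 250], which exceeds [16 t / 4096 = t / 256]. *)
Lemma gain_beats_loss {R : realType} (E a b j k l : \bar R) (t r e : R) :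
  (0 <= E)%E -> (0 <= a)%E -> (0 <= b)%E -> (0 <= j)%E -> (0 <= k)%E -> (0 <= l)%E ->
  (a <= 1)%E -> (b <= r%:E * a)%E -> r <= (20 * 20)^-1 -> ((8 / 100 * t)%:E <= a)%E ->
  (l <= (16 * t * e)%:E)%E -> 0 <= t -> e <= (64 * 64)^-1 -> (k <= j)%E -> (j < +oo)%E ->
  (E + ((10^-1)%:E * a + j) <= 2%:R%:E + 20%:E * b + (k + l))%E -> (E <= 2%:R%:E)%E.
Proof.
case: a => [a| |]//; case: b => [b| |]//; case: j => [j| |]//; case: k => [k| |]//.
case: l => [l| |]//; case: E => [E| |]//.
rewrite -!EFinM -!EFinD !lee_fin => E0 a0 b0 j0 k0 l0 a1 br r1 ta lt t0 e1 kj _ H.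
have h1 : r * a <= (20 * 20)^-1 * a by rewrite ler_wpM2r.
have h2 : t * e <= t * (64 * 64)^-1 by rewrite ler_wpM2l.
by lra.
Qed.

Section small_slope.
Context {R : realType} (mu : probability (measurableTypeR R) R).
Local Notation T := (measurableTypeR R).
Local Notation tail := (tail mu).
Local Notation rtail := (rtail mu).
Hypotheses (sym : symmetric_measure mu) (star : star_tail mu).
Variables (w beta : R).
Hypotheses (w0 : 0 < w) (tail_w : tail w <= expR (-1)) (tail_u : expR (-1) <= tail (w / 4)).
Hypothesis betaE : beta = 60 * 56.
Variable f : R -> R.
Hypotheses (cf : cvx (f : R^o -> R)) (fb : exists m, forall x, m <= f x).
Hypotheses (fmon : {homo f : x y / x <= y}) (fa : f (- (32 * w)) = 0).
Hypothesis fslope : f (- (16 * w)) <= 4.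

Let C : R^o -> R -> Prop := cost mu beta.
Let cC : convex_cost C := convex_cost_rate sym beta^-1.
Let Q : R -> R := infc C (f : R^o -> R).
(** The slope, in units of [w], of the chord of [f] over [[- 32 w, - 16 w]]. By convexity it bounds
    [f] from below both to the right of 0 and to the left of [- 32 w], so that gain and loss are
    both compared with [theta ^+ 2]. *)
Let theta := f (- (16 * w)) / 16.
Let A (x : R) : R := Num.min (Num.max (f x) 0) 10^-1.
Let B (x : R) : R := A (x - 64 * w).

Let mQ : measurable_fun [set: T] (fun x : T => (expR (Q x))%:E).
Proof.
apply/measurable_EFinP; apply: measurableT_comp => //.
exact: measurable_infc_R.
Qed.

Let cfR (l x y : R) : 0 <= l <= 1 -> f (l * x + (1 - l) * y) <= l * f x + (1 - l) * f y.
Proof. exact: cf. Qed.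

Let Q_le x h r : C h r -> Q x <= f (x - h) + r.
Proof. exact: infc_le. Qed.

Let theta01 : 0 <= theta <= 4^-1.
Proof.
have : f (- (32 * w)) <= f (- (16 * w)) by apply: fmon; have := w0; lra.
by rewrite fa /theta; have := fslope; lra.
Qed.

Let f_ge x : 0 <= x -> 32 * theta <= f x.
Proof.
move=> x0; apply: (@le_trans _ _ (f 0)); last exact: fmon.
have h : 0 <= (2^-1 : R) <= 1 by apply/andP; split; lra.
have := @cfR 2^-1 (- (32 * w)) 0 h; rewrite fa.
have -> : 2^-1 * - (32 * w) + (1 - 2^-1) * 0 = - (16 * w) by field.
by rewrite /theta; lra.
Qed.

Let f_left x : x <= - (32 * w) -> - f x <= theta * ((- (32 * w) - x) / w).
Proof.
move=> xa; set y := - (32 * w) - x.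
have y0 : 0 <= y by rewrite /y; lra.
have d0 : 0 < 16 * w + y by have := w0; lra.
pose l := 16 * w / (16 * w + y).
have l01 : 0 <= l <= 1.
  by rewrite /l ler_pdivrMr// ler_pdivlMr// mul0r mul1r; have := w0; lra.
have := @cfR l x (- (16 * w)) l01.
have -> : l * x + (1 - l) * - (16 * w) = - (32 * w).
  by have := d0; rewrite /l /y => d1; field; rewrite gt_eqF//; lra.
rewrite fa => h.
have e1 : l * (16 * w + y) = 16 * w by rewrite /l divfK// gt_eqF.
have e2 : f (- (16 * w)) = 16 * theta by rewrite /theta; field.
rewrite e2 in h.
have h2 : 0 <= 16 * w * f x + y * (16 * theta).
  have : 0 <= (l * f x + (1 - l) * (16 * theta)) * (16 * w + y) by rewrite mulr_ge0// ltW.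
  have -> : (l * f x + (1 - l) * (16 * theta)) * (16 * w + y) =
      l * (16 * w + y) * f x + (16 * w + y - l * (16 * w + y)) * (16 * theta) by ring.
  by rewrite e1; lra.
rewrite mulrA ler_pdivlMr//; lra.
Qed.

Let A_ge0 x : 0 <= A x.
Proof. by rewrite /A le_min le_max lexx orbT/= invr_ge0. Qed.

Let A_le x : A x <= 10^-1.
Proof. by rewrite /A ge_min lexx orbT. Qed.

Let A_mon : {homo A : x y / x <= y}.
Proof.
move=> x y xy; rewrite /A le_min ge_min ge_min lexx orbT andbT.
apply/orP; left; rewrite ge_max !le_max lexx orbT (fmon xy)//.
Qed.

Let A_left x : x <= - (32 * w) -> A x = 0.
Proof.
move=> xa; have f0 : f x <= 0 by rewrite -fa; exact: fmon.
by rewrite /A (max_idPr f0) (min_idPl _)// invr_ge0.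
Qed.

Let A_small x : - (32 * w) <= x -> f x <= 10^-1 -> A x = f x.
Proof.
move=> xa fx; have f0 : 0 <= f x by rewrite -fa; exact: fmon.
by rewrite /A (max_idPl f0) (min_idPl _).
Qed.

(** A jump of [64 w] costs at most [(64 / 420)^2 <= (8 / 51)^2 <= 1/40]. *)
Let quad (h l : R) : 0 <= l <= 1 -> `|h| <= l * (64 * w) -> C h (l ^+ 2 / 40).
Proof.
move=> l01 hl; have w1 := w0.
apply: (@rate_leW _ _ _ ((h / (20 * 21 * w)) ^+ 2)); last first.
  by apply: cost_quadratic => //; nra.
have d0 : 0 < 20 * 21 * w by lra.
have h1 : `|h / (20 * 21 * w)| <= l * (8 / 51).
  rewrite normrM normfV (gtr0_norm d0) ler_pdivrMr//.
  have : 0 <= l * w by apply: mulr_ge0; lra.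
  by lra.
rewrite -real_normK ?num_real//.
apply: (@le_trans _ _ ((l * (8 / 51)) ^+ 2)).
  by rewrite lerXn2r ?nnegrE ?normr_ge0//; lra.
by rewrite exprMn; have := sqr_ge0 l; lra.
Qed.

(** The translated point is stopped at [- 32 w], where [f] vanishes: there [f] is nonnegative, and
    its truncation is still [B]. *)
Let xshift x := Num.max (x - 64 * w) (- (32 * w)).

Let fshift x : f (xshift x) <= 10^-1 -> B x = f (xshift x).
Proof.
rewrite /xshift /B => h.
have [le|lt] := leP (- (32 * w)) (x - 64 * w).
  by rewrite (max_idPl le) in h *; rewrite A_small.
by rewrite (max_idPr (ltW lt)) in h *; rewrite A_left ?ltW.
Qed.

Let fshift_gt x : 10^-1 < f (xshift x) -> B x = 10^-1.
Proof.
rewrite /xshift /B => h.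
have [le|lt] := leP (- (32 * w)) (x - 64 * w).
  rewrite (max_idPl le) in h; rewrite /A (max_idPl _) ?(min_idPr _)//; first exact: ltW.
  by apply: le_trans (ltW h); rewrite invr_ge0.
by move: h; rewrite (max_idPr (ltW lt)) fa ltNge invr_ge0 ler0n.
Qed.

Let xshift_le x : - (32 * w) <= x -> 0 <= x - xshift x <= 64 * w.
Proof.
by move=> xa; rewrite /xshift; have w1 := w0; case: (leP (x - 64 * w)) => ?; lra.
Qed.

Let small_point x : - (32 * w) <= x -> f x <= 10^-1 ->
  expR (Q x) + expR (- f x) + A x ^+ 2 / 10 <= 2 + 20 * B x ^+ 2.
Proof.
move=> xa fx.
have /andP[s0 s1] := xshift_le xa.
have fs : f (xshift x) <= f x by apply: fmon; lra.
have fs0 : 0 <= f (xshift x) by rewrite -fa; apply: fmon; rewrite /xshift le_max lexx orbT.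
rewrite A_small// fshift; last exact: le_trans fx.
apply: pointwise_small => //; first by rewrite fs0 fs.
move=> l l01.
have := Q_le x (quad (h := l * (x - xshift x)) l01 _) => /(_ _)/le_trans; apply.
  by rewrite ger0_norm; [case/andP: l01 => *; rewrite ler_wpM2l|case/andP: l01 => *; rewrite mulr_ge0].
rewrite lerD2r.
have -> : x - l * (x - xshift x) = l * xshift x + (1 - l) * x by ring.
by rewrite [leRHS]addrC; apply: cfR.
Qed.

(** The bound [Q <= b + 1/40] comes from a single jump of length at most [64 w], to the shifted
    point or, if [f] still exceeds 1/10 there, to [L]. *)
Let large_point x L : f L = 10^-1 -> L <= x <= L + 64 * w ->
  - (32 * w) <= x ->
  expR (Q x) + expR (- f x) + A x ^+ 2 / 10 + 3 / 100 <= 2 + 20 * B x ^+ 2.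
Proof.
move=> fL /andP[Lx xL] xa.
have fx : 10^-1 <= f x by rewrite -fL; exact: fmon.
have A2 : A x ^+ 2 / 10 <= 1 / 1000.
  have := A_ge0 x; have := A_le x.
  by move=> ? ?; nra.
apply: (@le_trans _ _ (expR (Q x) + expR (- f x) + 1 / 1000 + 3 / 100)); first lra.
have h01 : 0 <= (1 : R) <= 1 by rewrite ler01 lexx.
have q1 (h : R) : 0 <= h <= 64 * w -> Q x <= f (x - h) + 40^-1.
  move=> hw; have hh : `|h| <= 1 * (64 * w) by rewrite mul1r ger0_norm; lra.
  by have := Q_le x (quad h01 hh); rewrite expr1n [1 / 40]mul1r.
apply: pointwise_large => //.
  by rewrite A_ge0 A_le.
have [fs|fs] := leP (f (xshift x)) 10^-1.
  rewrite fshift//; have := q1 (x - xshift x) (xshift_le xa).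
  by rewrite subKr.
rewrite fshift_gt// -fL; have := q1 (x - L).
rewrite subKr; apply; lra.
Qed.

Let rho_le : tail (32 * w) <= (20 * 20)^-1.
Proof.
have w1 := w0.
apply: le_trans (tail_exp star w0 tail_w _) _; first by lra.
have -> : 32 * w / w = 32 by field; rewrite gt_eqF.
apply: le_trans (expRN_nat_le _) _.
have -> : 2^-1 ^+ 32 = 2^-1 ^+ 9 * 2^-1 ^+ 23 :> R by rewrite -exprD.
have : 2^-1 ^+ 23 <= 1 :> R by apply: exprn_ile1; lra.
have : 0 <= 2^-1 ^+ 23 :> R by apply: exprn_ge0; lra.
have -> : 2^-1 ^+ 9 = 512^-1 :> R by field.
by lra.
Qed.

Let shiftL s z : - (32 * w) <= s -> 64 * w <= z ->
  rtail (s + z) <= tail (z / 2) * rtail s.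
Proof.
by move=> sa wz; have w1 := w0; apply: (@rtail_shift _ _ sym star (32 * w)) => //; lra.
Qed.

(* Past the point [L] where [f] reaches [1/10], a gain [J] accrues on
   [[L, L + 64 w)]; it pays for [K], which stands for [e^Q] further to the
   right, where the pointwise estimate fails. *)
Let excess_gain : exists J K : T -> \bar R,
  [/\ measurable_fun setT J /\ measurable_fun setT K,
      (forall x, (0 <= J x)%E) /\ (forall x, (0 <= K x)%E),
      (\int[mu]_x K x <= \int[mu]_x J x)%E /\ (\int[mu]_x J x < +oo)%E,
      (forall x, x < - (32 * w) -> J x = 0%E) &
      (forall x, - (32 * w) <= x ->
        ((expR (Q x) + expR (- f x) + A x ^+ 2 / 10)%:E + J x <=
         (2 + 20 * B x ^+ 2)%:E + K x)%E)].
Proof.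
have w1 := w0.
(* If [f] never exceeds 1/10, [small_point] applies at every point right of [- 32 w], and there is
   nothing to pay for. *)
have [[x1 fx1]|nofx] := pselect (exists x, 10^-1 < f x); last first.
  exists (cst 0%E), (cst 0%E); split => //.
    by rewrite integral0.
  move=> x xa; rewrite !adde0 lee_fin; apply: small_point => //.
  by rewrite leNgt; apply/negP => fx; apply: nofx; exists x.
have x1a : - (32 * w) <= x1.
  rewrite leNgt; apply/negP => x1a.
  have : f x1 <= 0 by rewrite -fa; apply: fmon; exact: ltW.
  by have : 0 < 10^-1 :> R by []; lra.
have [L /andP[La Lx1] fL] : exists2 L, - (32 * w) <= L <= x1 & f L = 10^-1.
  have [||L] := @IVT _ f (- (32 * w)) x1 10^-1 x1a.
  - apply: continuous_subspaceT; exact: cvx_real_continuous.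
  - have ge0 : 0 <= 10^-1 :> R by [].
    by rewrite fa ge_min le_max ge0 (ltW fx1) orbT.
  by rewrite in_itv/= => *; exists L.
pose DJ : set T := `[L, L + 64 * w[%classic.
pose DK : set T := `[L + 64 * w, +oo[%classic.
have mDJ : measurable DJ by exact: measurable_itv.
have mDK : measurable DK by exact: measurable_itv.
exists ((cst (3 / 100)%:E) \_ DJ), ((fun x => (expR (Q x))%:E) \_ DK); split.
- split; apply/(measurable_restrictT _ _).1 => //; exact: measurable_funTS.
- by split => x; apply: erestrict_ge0 => // *; rewrite lee_fin ?expR_ge0//; lra.
- rewrite -!integral_mkcond integral_cst//=.
  have muJ : mu DJ = (rtail L - rtail (L + 64 * w))%:E.
    have E : mu `[L, +oo[%classic = (mu DJ + mu DK)%E.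
      rewrite -measureU//; last first.
        apply/seteqP; split => x //; rewrite /DJ/DK/= !in_itv/= andbT => -[].
        by move=> /andP[_ h1] h2; lra.
      congr (mu _); apply/seteqP; split => x; rewrite /DJ/DK/= !in_itv/= !andbT.
        move=> h; rewrite h/=; case: (ltP x (L + 64 * w)) => ?; [by left|by right].
      by move=> [/andP[]//|h]; lra.
    move: E; rewrite !rtailE.
    have : mu DJ \is a fin_num by exact: fin_num_measure.
    case: (mu DJ) => [j| |]// _; rewrite -EFinD => -[E]; congr EFin; lra.
  rewrite muJ -EFinM ltry; split => //.
  (* A jump back to [L], where [f = 1/10], bounds [Q x]; factoring this value out leaves the cost
     alone. The outcome, at most [rtail L / 90], is below the gain of [3/100] on the mass
     [rtail L - rtail (L + 64 w)], nearly all of [rtail L]. *)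
  pose g (x : T) := (expR (Q x - 10^-1))%:E.
  have mg : measurable_fun setT g.
    rewrite (_ : g = (fun x : T => (expR (- 10^-1))%:E * (expR (Q x))%:E)%E).
      exact: measurable_funeM.
    by apply/funext => x; rewrite /g -EFinM -expRD addrC.
  have KE : (\int[mu]_(x in DK) (expR (Q x))%:E =
      (expR 10^-1)%:E * \int[mu]_(x in DK) g x)%E.
    transitivity (\int[mu]_(x in DK) ((expR 10^-1)%:E * g x))%E.
      by apply: eq_integral => x _; rewrite -EFinM -expRD addrC subrK.
    apply: ge0_integralZl_EFin => //.
    - by move=> x _; rewrite lee_fin expR_ge0.
    exact: measurable_funTS.
  have gle : (\int[mu]_(x in DK) g x <= (100^-1 * rtail L)%:E)%E.
    apply: (@tail_integral _ _ sym star w w0 tail_w beta betaE L (64 * w)) => //.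
    - by lra.
    - by move=> z wz; exact: shiftL.
    - by move=> x; rewrite lee_fin expR_ge0.
    - move=> x r xL hr; rewrite lee_fin ler_expR lerBlDl -fL.
      have := @Q_le x (x - L) r; rewrite subKr; apply.
      apply: cost_mono hr => //.
      by rewrite !ger0_norm; lra.
  rewrite KE; apply: (@le_trans _ _ ((expR 10^-1)%:E * (100^-1 * rtail L)%:E)%E).
    by rewrite lee_pmul2l// lte_fin expR_gt0.
  rewrite -EFinM lee_fin.
  have e1 : expR 10^-1 <= 10 / 9 :> R.
    apply: le_trans (expR_le_invB _) _; first lra.
    by rewrite -[(_)^-1]mul1r ler_pdivrMr; lra.
  have := @shiftL L (64 * w) La (lexx _).
  have -> : 64 * w / 2 = 32 * w by field.
  have := rtail_ge0 mu L; have := rho_le; have := tail_ge0 mu (32 * w).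
  set r := rtail L; set t := tail _ => t0 t1 r0 h.
  have : t * r <= (20 * 20)^-1 * r by rewrite ler_wpM2r.
  have : expR 10^-1 * (100^-1 * r) <= 10 / 9 * (100^-1 * r).
    by rewrite ler_wpM2r// mulr_ge0.
  by lra.
- move=> x xa; rewrite patchE ifF//; apply/negbTE; rewrite notin_setE /DJ/= in_itv/=.
  by move=> /andP[h _]; lra.
move=> x xa; rewrite !patchE.
have [xJ|xJ] := boolP (x \in DJ).
  move: xJ; rewrite inE /DJ/= in_itv/= => /andP[Lx xL].
  rewrite ifF; last by apply/negbTE; rewrite notin_setE /DK/= in_itv/= andbT; lra.
  by rewrite adde0 -EFinD lee_fin; apply: large_point fL _ xa; rewrite Lx ltW.
move: xJ; rewrite notin_setE /DJ/= in_itv/= => xJ; rewrite adde0.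
have [xK|xK] := boolP (x \in DK).
  move: xK; rewrite inE /DK/= in_itv/= andbT => xK.
  have fx : 10^-1 <= f x by rewrite -fL; apply: fmon; lra.
  have BE : B x = 10^-1.
    have f0 : 10^-1 <= f (x - 64 * w) by rewrite -fL; apply: fmon; lra.
    have p0 : 0 <= 10^-1 :> R by [].
    by rewrite /B /A (max_idPl (le_trans p0 f0)) (min_idPr f0).
  rewrite BE -EFinD lee_fin.
  have e1 : expR (- f x) <= 1 by rewrite expR_le1; have p0 : 0 <= 10^-1 :> R by []; lra.
  have := A_ge0 x; have := A_le x => *.
  by have : A x ^+ 2 <= 1; [rewrite -(expr1n _ 2) lerXn2r ?nnegrE//; lra|lra].
move: xK; rewrite notin_setE /DK/= in_itv/= andbT => xK.
have xL : x < L by lra.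
rewrite adde0 lee_fin; apply: small_point => //; rewrite -fL; apply: fmon; exact: ltW.
Qed.

(* Left of [-32 w] the function [f] is negative; convexity bounds it linearly, so
   the loss is of second order in [theta], like the gain from [A]. *)
Let loss (x : T) : \bar R :=
  (16 * theta ^+ 2 * expR ((- (32 * w) - x) / (2 * w)))%:E.

Let mloss : measurable_fun [set: T] (loss \_ `]-oo, (- (32 * w))[).
Proof.
apply/(measurable_restrictT _ _).1 => //; apply: measurable_funTS.
apply/measurable_EFinP; apply: measurable_funM => //.
apply: measurableT_comp => //; apply: measurable_funM => //.
exact: measurable_funB.
Qed.

Let loss_ge0 x : (0 <= loss x)%E.
Proof. by rewrite lee_fin mulr_ge0 ?expR_ge0// mulr_ge0// sqr_ge0. Qed.

(** After reflection, on blocks of length [2 w], the bound on the exponential grows by [e] from one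
    block to the next while that on the tail decays by [e^2], starting from [e^(-32)]. *)
Let loss_integral :
  (\int[mu]_x ((loss \_ `]-oo, (- (32 * w))%R[) x) <=
   (16 * theta ^+ 2 * expR (- 12%:R))%:E)%E.
Proof.
have w1 := w0.
rewrite -(symmetric_integral sym)//; last by move=> x; exact: erestrict_ge0.
pose g (x : T) : \bar R := (16 * theta ^+ 2 * expR ((x - 32 * w) / (2 * w)))%:E.
have mg : measurable_fun setT g.
  apply/measurable_EFinP; apply: measurable_funM => //.
  apply: measurableT_comp => //; apply: measurable_funM => //.
  exact: measurable_funB.
have g0 x : (0 <= g x)%E.
  by rewrite lee_fin mulr_ge0 ?expR_ge0// mulr_ge0// sqr_ge0.
apply: (@le_trans _ _ (\int[mu]_(x in `[(32 * w)%R, +oo[) g x)%E).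
  rewrite [leRHS]integral_mkcond; apply: ge0_le_integral => //.
  - by move=> x _; exact: erestrict_ge0.
  - by apply: (measurableT_comp mloss); exact: oppr_measurable.
  - by apply/(measurable_restrictT _ _).1 => //; exact: measurable_funTS.
  - move=> x _; rewrite !patchE.
    have [xL|xL] := boolP (- x \in _); last exact: erestrict_ge0.
    move: xL; rewrite inE/= in_itv/= => xL.
    rewrite ifT; last by rewrite inE/= in_itv/= andbT; lra.
    by rewrite /loss /g opprK addrC.
have t20 : 0 <= 16 * theta ^+ 2 by rewrite mulr_ge0// sqr_ge0.
apply: (@block_integral_le _ _ _ (2 * w)) => //; first by lra.
  by rewrite mulr_ge0// expR_ge0.
move=> j; set D := `[_, _[%classic.
have j0 : 0 <= j%:R :> R by exact: ler0n.
have jw : 0 <= j%:R * w by rewrite mulr_ge0// ltW.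
apply: (@le_trans _ _ ((16 * theta ^+ 2 * expR j.+1%:R)%:E * mu D)%E).
  apply: integral_le_cst; [exact: measurable_itv|exact: measurable_funTS|].
  move=> x; rewrite g0 /D/= in_itv/= => /andP[_ xj].
  rewrite lee_fin ler_wpM2l// ler_expR ler_pdivrMr; last by lra.
  by rewrite -natr1; lra.
have muD : (mu D <= (expR (- (32 + 2 * j%:R)) / 2)%:E)%E.
  apply: (@le_trans _ _ (rtail (32 * w + j%:R * (2 * w)))%:E).
    rewrite -rtailE le_measure ?inE//; first exact: measurable_itv.
    by move=> x; rewrite /D/= !in_itv/= andbT => /andP[].
  rewrite lee_fin.
  have p0 : 0 < 32 * w + j%:R * (2 * w) by lra.
  have := tail_rtail sym p0.
  have := @tail_exp _ _ star w w0 tail_w (32 * w + j%:R * (2 * w)).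
  have -> : (32 * w + j%:R * (2 * w)) / w = 32 + 2 * j%:R by field; rewrite gt_eqF.
  by move=> /(_ _) h1 h2; have := h1 ltac:(lra); lra.
apply: (@le_trans _ _ ((16 * theta ^+ 2 * expR j.+1%:R)%:E *
    (expR (- (32 + 2 * j%:R)) / 2)%:E)%E).
  by apply: lee_wpmul2l => //; rewrite lee_fin mulr_ge0// expR_ge0.
rewrite -EFinM lee_fin -[X in X <= _]mulrA -[X in _ <= X]mulrA ler_wpM2l//.
have -> : expR j.+1%:R * (expR (- (32 + 2 * j%:R)) / 2) = expR (- 31 - j%:R) / 2 :> R.
  by rewrite mulrA -expRD -natr1; congr (expR _ / _); ring.
apply: (@le_trans _ _ (expR (- 12%:R) * 2^-1 ^+ j / 2)).
  rewrite ler_wpM2r ?invr_ge0//.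
  apply: (@le_trans _ _ (expR (- 12%:R) * expR (- j%:R))).
    by rewrite -expRD ler_expR; lra.
  by rewrite ler_wpM2l ?expR_ge0// expRN_nat_le.
by rewrite natrX exprS invfM exprVn -mulrA [_ / 2]mulrC.
Qed.

(** Since [Q <= f], the sum is at most [2 cosh f <= 2 + f^2 e^(-f)]. If [s] is the distance to
    [- 32 w] in units of [w], then [- f <= theta s <= s / 4] and [f^2 <= 16 theta^2 (s / 4)^2 <= 16
    theta^2 e^(s / 4)]. *)
Let left_point x : x < - (32 * w) ->
  ((expR (Q x) + expR (- f x))%:E <= 2%:E + loss x)%E.
Proof.
move=> xa; have w1 := w0.
have f0 : f x <= 0 by rewrite -fa; apply: fmon; exact: ltW.
have Qf : Q x <= f x by exact: infc_le_id.
have v0 : 0 <= - f x by lra.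
have := cosh_le v0; rewrite opprK.
have eQ : expR (Q x) <= expR (f x) by rewrite ler_expR.
have := f_left (ltW xa).
set s := (- (32 * w) - x) / w => vs.
have s0 : 0 <= s by rewrite /s divr_ge0 ?(ltW w0)//; lra.
have [th0 th1] := andP theta01.
have e1 : expR (- f x) <= expR (s / 4).
  by rewrite ler_expR; apply: le_trans vs _; rewrite mulrC ler_wpM2l.
have e2 : (- f x) ^+ 2 <= 16 * theta ^+ 2 * (s / 4) ^+ 2.
  apply: (@le_trans _ _ ((theta * s) ^+ 2)); last by rewrite exprMn; lra.
  by rewrite lerXn2r ?nnegrE// mulr_ge0.
have s4 : 0 <= s / 4 by lra.
have e3 := sqr_le_expR s4.
rewrite -EFinD lee_fin.
have -> : (- (32 * w) - x) / (2 * w) = s / 4 + s / 4.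
  by rewrite /s; field; rewrite gt_eqF.
rewrite expRD.
have e4 : (- f x) ^+ 2 * expR (- f x) <=
    16 * theta ^+ 2 * (expR (s / 4) * expR (s / 4)).
  rewrite mulrA; apply: ler_pM => //; rewrite ?sqr_ge0 ?expR_ge0//.
  by apply: le_trans e2 _; rewrite ler_wpM2l// mulr_ge0// sqr_ge0.
by lra.
Qed.

Let mexpRNf : measurable_fun [set: T] (fun x : T => (expR (- f x))%:E).
Proof.
apply/measurable_EFinP; apply: measurableT_comp => //.
by apply: measurableT_comp => //; exact: nondecreasing_measurable.
Qed.

Let mA2 : measurable_fun [set: T] (fun x : T => (A x ^+ 2)%:E).
Proof.
apply/measurable_EFinP; apply: measurable_funX.
exact: nondecreasing_measurable.
Qed.

Let mB2 : measurable_fun [set: T] (fun x : T => (B x ^+ 2)%:E).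
Proof.
apply/measurable_EFinP; apply: measurable_funX.
by apply: nondecreasing_measurable => // x y xy; apply: A_mon; lra.
Qed.

Let B2_le : (\int[mu]_x (B x ^+ 2)%:E <= (tail (32 * w))%:E * \int[mu]_x (A x ^+ 2)%:E)%E.
Proof.
apply: (@integral_shift_le _ _ (32 * w) (64 * w) (tail (32 * w)) _ _ (fun x => A x ^+ 2)).
- exact: tail_ge0.
- move=> s sa; apply: le_trans (shiftL sa (lexx _)) _.
  by have -> : 64 * w / 2 = 32 * w by field.
- by move=> x; exact: sqr_ge0.
- by move=> x y xy; rewrite lerXn2r ?nnegrE ?A_ge0// A_mon.
- by move=> x xa; rewrite A_left// expr0n.
Qed.

(** At least half of the mass lies on [[0, +oo[], where [f >= 32 theta]; the truncation at 1/10
    still leaves [A >= 4/10 theta], as [theta <= 1/4]. *)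
Let A2_ge : ((8 / 100 * theta ^+ 2)%:E <= \int[mu]_x (A x ^+ 2)%:E)%E.
Proof.
have [th0 th1] := andP theta01.
apply: (@le_trans _ _ (\int[mu]_(x in `[0%R, +oo[) (A x ^+ 2)%:E)%E); last first.
  apply: ge0_subset_integral => //.
  by move=> x _; rewrite lee_fin sqr_ge0.
apply: (@le_trans _ _ ((16 / 100 * theta ^+ 2)%:E * mu `[0%R, +oo[%classic)%E).
  rewrite rtailE -EFinM lee_fin.
  have := rtail0_ge sym; have := sqr_ge0 theta; nra.
rewrite -integral_cst//; apply: ge0_le_integral => //.
- by move=> x _; rewrite lee_fin mulr_ge0// sqr_ge0.
- exact: measurable_funTS.
move=> x /=; rewrite in_itv/= andbT => x0; rewrite lee_fin.
have a1 : 4 / 10 * theta <= A x.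
  rewrite /A le_min le_max; apply/andP; split; last by lra.
  by apply/orP; left; have := f_ge x0; lra.
have : (4 / 10 * theta) ^+ 2 <= A x ^+ 2.
  by rewrite lerXn2r ?nnegrE//; lra.
by rewrite exprMn; lra.
Qed.

Lemma small_slope_sum :
  (\int[mu]_x (expR (Q x))%:E + \int[mu]_x (expR (- f x))%:E <= 2%:R%:E)%E.
Proof.
have [J [K [[mJ mK] [J0 K0] [KJ Jfin] Jleft JKpt]]] := excess_gain.
have A20 x : (0 <= (A x ^+ 2)%:E)%E by rewrite lee_fin sqr_ge0.
have B20 x : (0 <= (B x ^+ 2)%:E)%E by rewrite lee_fin sqr_ge0.
have e0 (h : T -> R) x : (0 <= (expR (h x))%:E)%E by rewrite lee_fin expR_ge0.
pose Lo := loss \_ `]-oo, (- (32 * w))[.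
have Lo0 x : (0 <= Lo x)%E by exact: erestrict_ge0.
have mcA : measurable_fun setT (fun x : T => (10^-1)%:E * (A x ^+ 2)%:E)%E.
  exact: measurable_funeM.
have mcB : measurable_fun setT (fun x : T => 20%:E * (B x ^+ 2)%:E)%E.
  exact: measurable_funeM.
have S1 x : (0 <= (expR (Q x))%:E + (expR (- f x))%:E)%E by rewrite adde_ge0.
have cA0 x : (0 <= (10^-1)%:E * (A x ^+ 2)%:E)%E by apply: mule_ge0 => //; rewrite lee_fin.
have cB0 x : (0 <= 20%:E * (B x ^+ 2)%:E)%E by apply: mule_ge0 => //; rewrite lee_fin.
have S2 x : (0 <= (10^-1)%:E * (A x ^+ 2)%:E + J x)%E by rewrite adde_ge0.
have S3 x : (0 <= cst 2%:R%:E x + 20%:E * (B x ^+ 2)%:E)%E.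
  by rewrite adde_ge0//= lee_fin.
have S4 x : (0 <= K x + Lo x)%E by rewrite adde_ge0.
have m1 : measurable_fun [set: T] (fun x : T => (expR (Q x))%:E + (expR (- f x))%:E)%E.
  exact: emeasurable_funD.
have m2 : measurable_fun [set: T] (fun x : T => (10^-1)%:E * (A x ^+ 2)%:E + J x)%E.
  exact: emeasurable_funD.
have m3 : measurable_fun [set: T] (fun x : T => cst 2%:R%:E x + 20%:E * (B x ^+ 2)%:E)%E.
  exact: emeasurable_funD.
have m4 : measurable_fun [set: T] (fun x : T => K x + Lo x)%E.
  exact: emeasurable_funD.
have main : (\int[mu]_x ((expR (Q x))%:E + (expR (- f x))%:E +
      ((10^-1)%:E * (A x ^+ 2)%:E + J x)) <=
    \int[mu]_x ((cst 2%:R%:E x + 20%:E * (B x ^+ 2)%:E) + (K x + Lo x)))%E.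
  apply: ge0_le_integral => //.
  - by move=> x _; rewrite adde_ge0.
  - exact: emeasurable_funD.
  - exact: emeasurable_funD.
  move=> x _; rewrite -!EFinM -!EFinD /cst /Lo patchE addeA -!EFinD.
  have [xa|xa] := leP (- (32 * w)) x.
    rewrite ifF; last by apply/negbTE; rewrite notin_setE/= in_itv/=; lra.
    by rewrite adde0 [10^-1 * _]mulrC; exact: JKpt.
  rewrite ifT; last by rewrite inE/= in_itv/=.
  rewrite Jleft// adde0 A_left ?(ltW xa)// expr0n/= mulr0 addr0.
  apply: le_trans (left_point xa) _.
  have -> : (2 + 20 * B x ^+ 2)%:E = (2%:R%:E + (20 * B x ^+ 2)%:E)%E :> \bar R by [].
  rewrite -addeA leeD2l// addeA [leRHS]addeC leeDl// adde_ge0//.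
  by rewrite lee_fin mulr_ge0// sqr_ge0.
move: main; rewrite ge0_integralD//.
rewrite ge0_integralD//.
rewrite ge0_integralD//.
rewrite [in leRHS]ge0_integralD//.
rewrite [in leRHS]ge0_integralD//.
rewrite [in leRHS]ge0_integralD//.
rewrite integral_cst//= probability_setT mule1.
rewrite ge0_integralZl_EFin//.
rewrite ge0_integralZl_EFin//.
apply: gain_beats_loss B2_le rho_le A2_ge loss_integral _ _ KJ Jfin.
- by rewrite adde_ge0//; exact: integral_ge0.
- exact: integral_ge0.
- exact: integral_ge0.
- exact: integral_ge0.
- exact: integral_ge0.
- exact: integral_ge0.
- have := @integral_le_cst _ mu setT (fun x : T => (A x ^+ 2)%:E) 1%E measurableT mA2.
  rewrite /= probability_setT mule1; apply => x _.
  rewrite A20/= lee_fin; have := A_ge0 x; have := A_le x => *.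
  by rewrite exprn_ile1//; lra.
- exact: sqr_ge0.
- apply: le_trans (expRN_nat_le _) _.
  have -> : 2^-1 ^+ 12 = ((64 * 64)^-1 : R) by field.
  exact: lexx.
- by move=> x _; rewrite lee_fin.
Qed.

End small_slope.

(** * Steep slopes *)

Section steep_slope.
Context {R : realType} (mu : probability (measurableTypeR R) R).
Local Notation T := (measurableTypeR R).
Local Notation tail := (tail mu).
Local Notation rtail := (rtail mu).
Hypotheses (sym : symmetric_measure mu) (star : star_tail mu).
Variables (w beta : R).
Hypotheses (w0 : 0 < w) (tail_w : tail w <= expR (-1)) (tail_u : expR (-1) <= tail (w / 4)).
Hypothesis betaE : beta = 60 * 56.

Lemma cvx_slopes (f : R -> R) (a b c : R) : cvx (f : R^o -> R) -> a < b -> b < c ->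
  (f b - f a) * (c - b) <= (f c - f b) * (b - a).
Proof.
move=> cf ab bc; have ca : 0 < c - a by lra.
have l01 : 0 <= (c - b) / (c - a) <= 1.
  by rewrite ler_pdivrMr// ler_pdivlMr// mul0r mul1r; lra.
have := cf _ a c l01; rewrite /GRing.scale/=.
have -> : (c - b) / (c - a) * a + (1 - (c - b) / (c - a)) * c = b.
  by field; rewrite gt_eqF.
set l := (c - b) / (c - a) => h.
have e : l * (c - a) = c - b by rewrite /l divfK// gt_eqF.
have : f b * (c - a) <= (l * f a + (1 - l) * f c) * (c - a) by rewrite ler_wpM2r// ltW.
have -> : (l * f a + (1 - l) * f c) * (c - a) =
    l * (c - a) * f a + (c - a - l * (c - a)) * f c by ring.
by rewrite e; lra.
Qed.

Lemma tail_geometric r q n : 0 <= r -> tail r <= q ->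
  tail (n.+1%:R * r) <= q ^+ n.+1.
Proof.
move=> r0 rq; have q0 : 0 <= q by apply: le_trans rq; exact: tail_ge0.
elim: n => [|n IH]; first by rewrite mul1r expr1.
rewrite -natr1 mulrDl mul1r exprSr; apply: le_trans (tail_mul star _ r0) _.
  by rewrite mulr_ge0.
by apply: ler_pM => //; exact: tail_ge0.
Qed.

(** Let [K = k r]. Left of [r] the integrand is at most [e^K]. On block [j] it is at most
    [e^(K (j + 2))], against a mass of at most [e^(-16 K (j + 1)) / 2]; the ratio [e^(-15 K)] left
    over is at most 1/2 because [K >= 1/16]. *)
Lemma exp_moment k r : 0 <= k -> 0 < r -> 16^-1 <= k * r ->
  tail r <= expR (- (16 * (k * r))) ->
  (mgf mu k <= (3 / 2 * expR (k * r))%:E)%E.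
Proof.
move=> k0 r0 kr rS; set K := k * r in kr rS *.
have meas D : measurable_fun D (fun x : T => (expR (k * x))%:E) by exact: measurable_expRM.
have h1 : (\int[mu]_(x in `]-oo, r[) (expR (k * x))%:E <= (expR K)%:E)%E.
  apply: (@le_trans _ _ ((expR K)%:E * mu `]-oo, r[%classic)%E).
    apply: integral_le_cst => // x /=; rewrite in_itv/= => xr.
    by rewrite !lee_fin expR_ge0/= ler_expR ler_wpM2l// ltW.
  rewrite -[leRHS]mule1; apply: lee_wpmul2l; first by rewrite lee_fin expR_ge0.
  exact: probability_le1.
have h2 : (\int[mu]_(x in `[r, +oo[) (expR (k * x))%:E <= (2^-1 * expR K)%:E)%E.
  apply: (@block_integral_le _ _ _ r) => //.
  move=> j; set D := `[_, _[%classic.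
  have mD : measurable D by exact: measurable_itv.
  have jr : 0 <= j%:R * r by rewrite mulr_ge0// ltW.
  apply: (@le_trans _ _ ((expR (K * j.+2%:R))%:E * mu D)%E).
    apply: integral_le_cst => // x; rewrite /D/= in_itv/= => /andP[_ xr].
    rewrite !lee_fin expR_ge0/= ler_expR /K -mulrA ler_wpM2l//.
    by rewrite -2!natr1; lra.
  have muD : (mu D <= (expR (- (16 * K)) ^+ j.+1 / 2)%:E)%E.
    apply: (@le_trans _ _ (rtail (r + j%:R * r))%:E).
      rewrite -rtailE le_measure ?inE//.
      by move=> x; rewrite /D/= !in_itv/= andbT => /andP[].
    rewrite lee_fin; have p0 : 0 < r + j%:R * r by lra.
    have := tail_rtail sym p0; have := tail_geometric j (ltW r0) rS.
    rewrite -natr1 mulrDl mul1r [r + _]addrC; lra.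
  apply: (@le_trans _ _ ((expR (K * j.+2%:R))%:E * (expR (- (16 * K)) ^+ j.+1 / 2)%:E)%E).
    by apply: lee_wpmul2l => //; rewrite lee_fin expR_ge0.
  rewrite -EFinM lee_fin -expRM_natr.
  have -> : expR (K * j.+2%:R) * (expR (- (16 * K) * j.+1%:R) / 2) =
      2^-1 * expR K * expR (- (15 * K) * j.+1%:R).
    rewrite [RHS]mulrAC -[in RHS]mulrA -expRD mulrA -expRD mulrC; congr (_ * expR _).
    by rewrite -2!natr1; ring.
  rewrite -mulrA -[leRHS]mulrA ler_wpM2l// ler_wpM2l ?expR_ge0//.
  rewrite expRM_natr natrX -exprVn lerXn2r ?nnegrE ?expR_ge0// expRN lef_pV2 ?posrE ?expR_gt0//.
  have -> : 15 * K = 2%:R * (15 / 2 * K) by field.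
  rewrite expRM_natl; have := expR_ge1Dx (15 / 2 * K); nra.
rewrite /mgf.
have -> : [set: T] = `]-oo, r[%classic `|` `[r, +oo[%classic.
  by rewrite -setCitvl setUv.
rewrite ge0_integral_setU//; last first.
  apply/disj_setPS => x /=; rewrite !in_itv/= andbT => -[a b].
  by have := lt_le_trans a b; rewrite ltxx.
by apply: le_trans (leeD h1 h2) _; rewrite -EFinD lee_fin; lra.
Qed.

Section choice.
Variable f : R -> R.
Hypotheses (cf : cvx (f : R^o -> R)) (fb : exists m, forall x, m <= f x).
Hypotheses (fmon : {homo f : x y / x <= y}).
Hypothesis fslope : 4 < f (- (16 * w)) - f (- (32 * w)).

(* [t] is the last of the scales [4 ^ j * 16 w] along which the increments of
   [f] dominate [- 4 ln (tail (t / 64))]; [p] interpolates between consecutive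
   increments. *)
Lemma steep_choice : exists t p, [/\ 16 * w <= t, 1 <= p,
  (f (- (4 * t)) - f (- (8 * t))) / 4 <= p <= f (- t) - f (- (2 * t)),
  tail (t / 16) <= expR (- p) & expR (- (p / 4)) <= tail (t / 64)].
Proof.
have w1 := w0.
pose t (j : nat) : R := 4 ^+ j * (16 * w).
have p4 (j : nat) : 1 <= 4 ^+ j :> R by apply: exprn_ege1; lra.
have tw j : 16 * w <= t j by rewrite /t ler_peMl//; lra.
have t0 j : 0 < t j by have := tw j; lra.
have tS j : t j.+1 = 4 * t j by rewrite /t exprS -mulrA.
pose D j := f (- t j) - f (- (2 * t j)).
pose c j := expR (- (D j / 4)) <= tail (t j / 64).
have c0 : c 0%N.
  rewrite /c /D /t expr0 mul1r.
  have -> : 16 * w / 64 = w / 4 by field.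
  apply: le_trans tail_u; rewrite ler_expR.
  have -> : 2 * (16 * w) = 32 * w by ring.
  by have := fslope; lra.
have cD j : c j -> 1 <= D j.
  case: j => [_|j cj].
    rewrite /D /t expr0 mul1r (_ : 2 * (16 * w) = 32 * w); last by ring.
    by apply: ltW; apply: lt_trans fslope; lra.
  have wt : w <= t j.+1 / 64 by rewrite tS; have := tw j; lra.
  have := le_trans cj (tail_exp star w0 tail_w wt).
  rewrite ler_expR => h.
  have : 1 <= t j.+1 / 64 / w by rewrite ler_pdivlMr// mul1r.
  lra.
have cDj j : c j.+1 -> 4 ^+ j.+1 <= D j.+1.
  move=> cj; have wt : w <= t j.+1 / 64 by rewrite tS; have := tw j; lra.
  have := le_trans cj (tail_exp star w0 tail_w wt).
  rewrite ler_expR.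
  have -> : t j.+1 / 64 / w = 4 ^+ j.+1 / 4 by rewrite /t; field; rewrite gt_eqF.
  lra.
have [m hm] := fb.
have Dm j : D j <= f 0 - m.
  have : f (- t j) <= f 0 by apply: fmon; have := t0 j; lra.
  by have := hm (- (2 * t j)); rewrite /D; lra.
(* If [c j] held for every [j], the subexponential tails would force [D j >= 4 ^+ j], against the
   bound [f 0 - m] on increments. *)
have exn : exists j, ~~ c j.
  exists (Num.truncn (f 0 - m)).+1; apply/negP => /cDj.
  set N := (Num.truncn _).+1 => h.
  have fm0 : 0 <= f 0 - m by have := hm 0; lra.
  have /andP[_] := truncn_itv fm0; rewrite -/N => h2.
  have : N%:R < 4 ^+ N :> R by rewrite -natrX ltr_nat; exact: ltn_expl.
  by have := Dm N; lra.
case: (ex_minnP exn) => -[|j]; first by rewrite c0.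
move=> ncj minj; have cj : c j.
  by apply/negPn/negP => /minj; rewrite ltnn.
have {}ncj : tail (t j / 16) < expR (- (D j.+1 / 4)).
  have := ncj; rewrite /c -ltNge tS.
  by have -> : 4 * t j / 64 = t j / 16 by field.
have DE : D j.+1 = f (- (4 * t j)) - f (- (8 * t j)).
  by rewrite /D tS; congr (f _ - f _); ring.
(* The increments are taken over intervals of length [4 t] and [t], the longer one further left,
   where a convex function has smaller slopes. *)
have DD : D j.+1 / 4 <= D j.
  have t1 := t0 j.
  have s1 : (f (- (4 * t j)) - f (- (8 * t j))) * (2 * t j) <=
      (f (- (2 * t j)) - f (- (4 * t j))) * (4 * t j).
    have h1 : - (8 * t j) < - (4 * t j) by lra.
    have h2 : - (4 * t j) < - (2 * t j) by lra.
    by have := cvx_slopes cf h1 h2; lra.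
  have s2 : (f (- (2 * t j)) - f (- (4 * t j))) * t j <=
      (f (- t j) - f (- (2 * t j))) * (2 * t j).
    have h1 : - (4 * t j) < - (2 * t j) by lra.
    have h2 : - (2 * t j) < - t j by lra.
    by have := cvx_slopes cf h1 h2; lra.
  by rewrite DE /D -(ler_pM2r t1); lra.
have tw16 : w <= t j / 16 by have := tw j; lra.
have e16 : expR (- (t j / 16 / w)) <= expR (-1).
  by rewrite ler_expR lerN2 ler_pdivlMr// mul1r.
(* The choice [p = D j] works if the tail at [t / 16] is small enough. Otherwise [p] is minus the
   logarithm of that tail, which lies between [D j.+1 / 4] and [D j], and star-shapedness with ratio
   1/4 carries it to [t / 64]. *)
have [SD|SD] := leP (tail (t j / 16)) (expR (- D j)).
  by exists (t j), (D j); split => //; [exact: cD|rewrite -DE DD lexx].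
have S0 : 0 < tail (t j / 16) by apply: lt_trans SD; exact: expR_gt0.
exists (t j), (- ln (tail (t j / 16))); split => //.
- rewrite lerNr -ler_expR lnK//.
  exact: le_trans (tail_exp star w0 tail_w tw16) e16.
- rewrite -DE; apply/andP; split.
    by rewrite lerNr -ler_expR lnK// ltW.
  by rewrite lerNl -ler_expR lnK// ltW.
- by rewrite opprK lnK.
have h4 : 0 <= (4^-1 : R) <= 1 by apply/andP; split; lra.
have := @star (t j / 16) 4^-1 _ h4 S0.
have -> : 4^-1 * (t j / 16) = t j / 64 by field.
have -> : - (- ln (tail (t j / 16)) / 4) = 4^-1 * ln (tail (t j / 16)) by field.
by apply; have := t0 j; lra.
Qed.

(** The point [z] minimises [f x - (p / t) x] over [[- 8 t, - t]]. The minimum is global, because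
    the mean slope of [f] is at most [p / t] on [[- 8 t, - 4 t]] and at least [p / t] on
    [[- 2 t, - t]]. *)
Lemma steep_touch t p : 0 < t ->
  (f (- (4 * t)) - f (- (8 * t))) / 4 <= p <= f (- t) - f (- (2 * t)) ->
  exists2 z, - (8 * t) <= z <= - t & forall x, f z + p / t * (x - z) <= f x.
Proof.
move=> t0 /andP[p1 p2].
pose k := p / t; have kt : k * t = p by rewrite /k divfK// gt_eqF.
have ab : - (8 * t) <= - t by lra.
have fc : {within `[- (8 * t), - t], continuous (fun x => f x - k * x)}.
  apply: continuous_subspaceT => x; apply: cvgB; first exact: cvx_real_continuous.
  by apply: cvgM; [exact: cvg_cst|exact: cvg_id].
have [z] := EVT_min ab fc.
rewrite in_itv/= => zab zmin; exists z => // x; rewrite -/k.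
have zmin1 : f z - k * z <= f (- t) - k * - t.
  by apply: zmin; rewrite in_itv/= lexx andbT; lra.
have zmin8 : f z - k * z <= f (- (8 * t)) - k * - (8 * t).
  by apply: zmin; rewrite in_itv/= lexx; lra.
have [xl|xl] := ltP x (- (8 * t)).
  have h48 : - (8 * t) < - (4 * t) by lra.
  have := @cvx_slopes f x (- (8 * t)) (- (4 * t)) cf xl h48.
  have := @ler_wpM2r _ (- (8 * t) - x) _ _ _ p1.
  have -> : - (4 * t) - - (8 * t) = 4 * t by ring.
  move=> h1 h2; have {}h1 := h1 ltac:(lra).
  have : (f (- (8 * t)) - f x) * t <= p * (- (8 * t) - x) by lra.
  rewrite -kt [k * t * _]mulrAC ler_pM2r//; lra.
have [xr|xr] := ltP (- t) x.
  have h21 : - (2 * t) < - t by lra.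
  have := @cvx_slopes f (- (2 * t)) (- t) x cf h21 xr.
  have := @ler_wpM2r _ (x - - t) _ _ _ p2.
  have -> : - t - - (2 * t) = t by ring.
  move=> h1 h2; have {}h1 := h1 ltac:(lra).
  have : p * (x - - t) <= (f x - f (- t)) * t by lra.
  rewrite -kt [k * t * _]mulrAC ler_pM2r//; lra.
have : f z - k * z <= f x - k * x by apply: zmin; rewrite in_itv/= xl.
by lra.
Qed.

End choice.

End steep_slope.

Lemma mule_le1 {R : realType} (a b : \bar R) : (0 <= a)%E -> (0 <= b)%E ->
  (a + b <= 2%:R%:E)%E -> (a * b <= 1)%E.
Proof.
case: a => [a| |]//; case: b => [b| |]//; rewrite -EFinD -EFinM !lee_fin => a0 b0 ab.
by have := sqr_ge0 (a - b); nra.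
Qed.

(** * The inequality for monotone functions *)

Section ic_prod.
Context {R : realType} (mu : probability (measurableTypeR R) R).
Local Notation T := (measurableTypeR R).

Lemma measurable_expR_infc (C : R^o -> R -> Prop) (f : R -> R) : convex_cost C ->
  cvx (f : R^o -> R) -> (exists m, forall x, m <= f x) ->
  measurable_fun [set: T] (fun x : T => (expR (infc C (f : R^o -> R) x))%:E).
Proof.
move=> cC cf fb; apply/measurable_EFinP; apply: measurableT_comp => //.
exact: measurable_infc_R.
Qed.

Lemma measurable_expRN_cvx (f : R -> R) : cvx (f : R^o -> R) ->
  measurable_fun [set: T] (fun x : T => (expR (- f x))%:E).
Proof.
move=> cf; apply/measurable_EFinP; apply: measurableT_comp => //.
apply: measurableT_comp => //; apply: continuous_measurable_fun.
exact: cvx_real_continuous.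
Qed.

(** Permits the normalisations [f (- 32 w) = 0] and [min f = 0]. *)
Lemma ic_prod_addr (C : R^o -> R -> Prop) (f : R -> R) : convex_cost C ->
  cvx (f : R^o -> R) -> (exists m, forall x, m <= f x) -> forall c,
  (\int[mu]_x (expR (infc C (fun x : R^o => f x + c) x))%:E *
    \int[mu]_x (expR (- (f x + c)))%:E =
  \int[mu]_x (expR (infc C (f : R^o -> R) x))%:E * \int[mu]_x (expR (- f x))%:E)%E.
Proof.
move=> cC cf fb c.
transitivity (((expR c)%:E * \int[mu]_x (expR (infc C (f : R^o -> R) x))%:E) *
    ((expR (- c))%:E * \int[mu]_x (expR (- f x))%:E))%E.
  congr (_ * _)%E.
    rewrite -ge0_integralZl_EFin ?expR_ge0//; last exact: measurable_expR_infc.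
    by apply: eq_integral => x _; rewrite -EFinM -expRD (infc_addr cC fb) addrC.
  rewrite -ge0_integralZl_EFin ?expR_ge0//; last exact: measurable_expRN_cvx.
  by apply: eq_integral => x _; rewrite -EFinM -expRD opprD addrC.
by rewrite muleACA -EFinM expRxMexpNx_1 mul1e.
Qed.

End ic_prod.

Section monotone_ic.
Context {R : realType} (mu : probability (measurableTypeR R) R).
Local Notation T := (measurableTypeR R).
Local Notation tail := (tail mu).
Hypotheses (sym : symmetric_measure mu) (star : star_tail mu).
Variables (w beta : R).
Hypotheses (w0 : 0 < w) (tail_w : tail w <= expR (-1)) (tail_u : expR (-1) <= tail (w / 4)).
Hypothesis betaE : beta = 60 * 56.

Local Notation C := (cost mu beta).

(** Here [g] stands for [e^(phi (2 x))], the cost being known only through [C]. For [|x| <= 32 w]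
    the quadratic bound gives at most [e^(1/40) <= 40/39], and each of the two tails adds at most
    1/100. *)
Lemma cost_moment (g : T -> \bar R) : measurable_fun setT g -> (forall x, (0 <= g x)%E) ->
  (forall x r, C (2 * x) r -> (g x <= (expR r)%:E)%E) ->
  (\int[mu]_x g x <= (21 / 20)%:E)%E.
Proof.
move=> mg g0 gC; have w1 := w0.
have half (h : T -> \bar R) : measurable_fun setT h -> (forall x, (0 <= h x)%E) ->
    (forall x r, C (2 * x) r -> (h x <= (expR r)%:E)%E) ->
    (\int[mu]_x (h \_ `[(32 * w)%R, +oo[) x <= (100^-1)%:E)%E.
  move=> mh h0 hC; rewrite -integral_mkcond.
  have := @tail_integral _ _ sym star w w0 tail_w beta betaE 0 (32 * w) h (lexx _) _ mh h0 _.
  rewrite add0r => H; apply: le_trans (H _ _) _.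
  - move=> z wz; apply: (@rtail_shift _ _ sym star 0) => //; lra.
  - by move=> x r _; rewrite subr0; exact: hC.
  by rewrite lee_fin ler_piMr// rtail_le1.
have mgN : measurable_fun setT (fun x : T => g (- x)%R).
  by apply: (measurableT_comp mg); exact: oppr_measurable.
have gN0 x : (0 <= g (- x)%R)%E by [].
pose h := g \_ `[(32 * w)%R, +oo[.
pose h' := (fun x : T => g (- x)) \_ `[(32 * w)%R, +oo[.
have h0 x : (0 <= h x)%E by exact: erestrict_ge0.
have h'0 x : (0 <= h' x)%E by exact: erestrict_ge0.
have mh : measurable_fun setT h.
  by apply/(measurable_restrictT _ _).1 => //; exact: measurable_funTS.
have mh' : measurable_fun setT h'.
  by apply/(measurable_restrictT _ _).1 => //; exact: measurable_funTS.
have mh'N : measurable_fun setT (fun x : T => h' (- x)).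
  by apply: (measurableT_comp mh'); exact: oppr_measurable.
have hh0 x : (0 <= h x + h' (- x)%R)%E by rewrite adde_ge0.
have mhh : measurable_fun setT (fun x : T => h x + h' (- x)%R)%E.
  exact: emeasurable_funD.
pose c : R := expR 40^-1.
have c0 : (0 <= c%:E)%E by rewrite lee_fin expR_ge0.
have cle : c <= 40 / 39.
  apply: le_trans (expR_le_invB _) _; first by lra.
  by rewrite -[(_)^-1]mul1r ler_pdivrMr; lra.
apply: (@le_trans _ _ (\int[mu]_x (cst c%:E x + (h x + h' (- x)%R)))%E).
  apply: ge0_le_integral => //.
    exact: emeasurable_funD.
  move=> x _; rewrite /cst.
  have [xw|xw] := leP `|x| (32 * w).
    apply: (@le_trans _ _ c%:E); last by rewrite leeDl.
    have hx : `|2 * x| <= 128 * w by rewrite normrM ger0_norm//; lra.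
    apply: le_trans (gC _ _ (cost_quadratic sym w0 tail_u betaE hx)) _.
    have d0 : 0 < 20 * 21 * w by lra.
    have q1 : (2 * x / (20 * 21 * w)) ^+ 2 <= 40^-1.
      rewrite -real_normK ?num_real//.
      have : `|2 * x / (20 * 21 * w)| <= 8 / 51.
        rewrite !normrM normfV (gtr0_norm d0) ler_pdivrMr// ger0_norm//; lra.
      by have := normr_ge0 (2 * x / (20 * 21 * w)); nra.
    by rewrite lee_fin ler_expR.
  apply: (@le_trans _ _ (h x + h' (- x)%R)%E); last by rewrite leeDr.
  have [x0|x0] := leP 0 x.
    apply: (@le_trans _ _ (h x)); last by rewrite leeDl.
    rewrite /h patchE ifT// inE/= in_itv/= andbT.
    by move: xw; rewrite ger0_norm// => /ltW.
  apply: (@le_trans _ _ (h' (- x)%R)); last by rewrite leeDr.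
  rewrite /h' patchE ifT ?opprK// inE/= in_itv/= andbT.
  by move: xw; rewrite ltr0_norm// => /ltW.
clearbody c.
rewrite ge0_integralD//.
rewrite ge0_integralD//.
rewrite integral_cst//= probability_setT mule1.
rewrite (symmetric_integral sym)//.
have H1 := half g mg g0 gC.
have H2 := half (fun x => g (- x)) mgN gN0 _.
have gCN (x r : R) : C (2 * x) r -> (g (- x)%R <= (expR r)%:E)%E.
  by move=> hr; apply: gC; apply: cost_mono hr => //; rewrite mulrN normrN.
have {}H2 := H2 gCN.
apply: le_trans (leeD (lexx _) (leeD H1 H2)) _.
by rewrite -!EFinD lee_fin; lra.
Qed.

(** At the origin the affine minorant touching at [z <= - t] exceeds [f z] by at least [p], which
    puts a factor [e^(-p)] into [E e^(-f)]. It has to pay for less: [p / 16] in the exponential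
    moment of slope [p / t], and [r2 / 2 <= 1/6 + p / 24] for half of the cost of [2 z]. *)
Lemma steep_product (f : R -> R) : cvx (f : R^o -> R) -> (exists m, forall x, m <= f x) ->
  {homo f : x y / x <= y} -> 4 < f (- (16 * w)) - f (- (32 * w)) ->
  (\int[mu]_x (expR (infc (C : R^o -> R -> Prop) (f : R^o -> R) x))%:E *
   \int[mu]_x (expR (- f x))%:E <= 1)%E.
Proof.
move=> cf fb fmon fslope; have w1 := w0.
have cC : convex_cost (C : R^o -> R -> Prop) := convex_cost_rate sym beta^-1.
have [t [p [wt p1 pp S16 S64]]] := steep_choice star w0 tail_w tail_u cf fb fmon fslope.
have t0 : 0 < t by lra.
have [z /andP[z1 z2] fz] := steep_touch cf t0 pp.
set Q := infc _ _.
(* A third of Chernoff's bound at [t / 64] buys a jump of [beta t / 192 = 17.5 t], enough for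
   [2 |z| <= 16 t]. *)
pose r2 := 3^-1 * (ln 2 - ln (tail (t / 64))).
have S0 : 0 < tail (t / 64) by apply: lt_le_trans S64; exact: expR_gt0.
have hr2 : C (- (2 * z)) r2.
  apply: cost_chernoff => //; first by lra.
    by apply/andP; split; lra.
  have z0 : 2 * z <= 0 by lra.
  by rewrite betaE normrN ler0_norm//; lra.
have l2 : ln 2 <= 1 :> R.
  by rewrite -ler_expR lnK ?posrE//; have := expR1_ge R; lra.
have r2le : r2 <= 3^-1 + p / 12.
  have : - (p / 4) <= ln (tail (t / 64)) by rewrite -ler_expR lnK.
  by rewrite /r2; lra.
pose g (x : T) := (expR (Q x - (f z + r2 / 2)))%:E.
have mQ : measurable_fun [set: T] (fun x : T => (expR (Q x))%:E).
  by apply/measurable_EFinP; apply: measurableT_comp => //; exact: measurable_infc_R.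
have gE x : (expR (Q x))%:E = ((expR (f z + r2 / 2))%:E * g x)%E.
  by rewrite /g -EFinM -expRD addrC subrK.
have mg : measurable_fun setT g.
  rewrite (_ : g = (fun x : T => (expR (- (f z + r2 / 2)))%:E * (expR (Q x))%:E)%E).
    exact: measurable_funeM.
  by apply/funext => x; rewrite /g -EFinM -expRD addrC.
have Ig : (\int[mu]_x g x <= (21 / 20)%:E)%E.
  apply: cost_moment => //; first by move=> x; rewrite lee_fin expR_ge0.
  move=> x r hr; rewrite lee_fin ler_expR.
  have h2 : 0 <= (2^-1 : R) <= 1 by apply/andP; split; lra.
  have := cost_cvx cC h2 hr hr2; rewrite /GRing.scale/=.
  have -> : 2^-1 * (2 * x) + (1 - 2^-1) * - (2 * z) = x - z by field.
  move=> /(infc_le cC fb x); rewrite -/Q subKr => h.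
  have := cost_ge0 cC hr; lra.
have IQ : (\int[mu]_x (expR (Q x))%:E <= (expR (f z + r2 / 2) * (21 / 20))%:E)%E.
  under eq_integral do rewrite gE.
  rewrite ge0_integralZl_EFin ?expR_ge0//; last by move=> x _; rewrite lee_fin expR_ge0.
  by rewrite EFinM; apply: lee_wpmul2l => //; rewrite lee_fin expR_ge0.
have kt : p / t * (t / 16) = p / 16 by field; rewrite gt_eqF.
have Im : (mgf mu (p / t) <= (3 / 2 * expR (p / 16))%:E)%E.
  rewrite -kt; apply: (exp_moment sym star); rewrite ?kt.
  - by rewrite divr_ge0//; lra.
  - by lra.
  - by lra.
  by have -> : 16 * (p / 16) = p by field.
have If : (\int[mu]_x (expR (- f x))%:E <=
    (expR (- f z - p) * (3 / 2 * expR (p / 16)))%:E)%E.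
  apply: (@le_trans _ _ ((expR (- f z - p))%:E * mgf mu (- (p / t)))%E).
    rewrite /mgf -ge0_integralZl_EFin ?expR_ge0//; last exact: measurable_expRM.
    apply: ge0_le_integral => //.
    + apply/measurable_EFinP; apply: measurableT_comp => //.
      by apply: measurableT_comp => //; exact: nondecreasing_measurable.
    + by apply: measurable_funeM; exact: measurable_expRM.
    move=> x _; rewrite -EFinM -expRD lee_fin ler_expR.
    have : p / t * z <= p / t * - t by rewrite ler_wpM2l// divr_ge0//; lra.
    have -> : p / t * - t = - p by field; rewrite gt_eqF.
    by have := fz x; lra.
  by rewrite (mgfN sym) EFinM; apply: lee_wpmul2l => //; rewrite lee_fin expR_ge0.
apply: le_trans (lee_pmul _ _ IQ If) _.
- by apply: integral_ge0 => x _; rewrite lee_fin expR_ge0.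
- by apply: integral_ge0 => x _; rewrite lee_fin expR_ge0.
rewrite -EFinM lee_fin.
have -> : expR (f z + r2 / 2) * (21 / 20) * (expR (- f z - p) * (3 / 2 * expR (p / 16))) =
    63 / 40 * expR (r2 / 2 - p + p / 16).
  have -> : r2 / 2 - p + p / 16 = (f z + r2 / 2) + ((- f z - p) + p / 16) by ring.
  by rewrite !expRD; field.
(* As [p >= 1], the exponent is at most [1/6 - 43/48 < - 7/10]. *)
have : expR (r2 / 2 - p + p / 16) <= expR (- (2%:R * (7 / 20))).
  by rewrite ler_expR; lra.
rewrite expRN expRM_natl => h.
have h2 := expR_ge1Dx (7 / 20 : R).
have h3 : 63 / 40 <= expR (7 / 20) ^+ 2 :> R by nra.
have h4 : 0 < expR (7 / 20) ^+ 2 :> R by rewrite exprn_gt0// expR_gt0.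
apply: (@le_trans _ _ (63 / 40 * (expR (7 / 20) ^+ 2)^-1)); first by lra.
by rewrite ler_pdivrMr// mul1r.
Qed.

Lemma ic_monotone (f : R -> R) : cvx (f : R^o -> R) -> (exists m, forall x, m <= f x) ->
  {homo f : x y / x <= y} ->
  (\int[mu]_x (expR (infc (C : R^o -> R -> Prop) (f : R^o -> R) x))%:E *
   \int[mu]_x (expR (- f x))%:E <= 1)%E.
Proof.
move=> cf fb fmon.
have [le4|] := leP (f (- (16 * w)) - f (- (32 * w))) 4; last exact: steep_product.
have cC : convex_cost (C : R^o -> R -> Prop) := convex_cost_rate sym beta^-1.
rewrite -(ic_prod_addr mu cC cf fb (- f (- (32 * w)))).
apply: mule_le1.
- by apply: integral_ge0 => x _; rewrite lee_fin expR_ge0.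
- by apply: integral_ge0 => x _; rewrite lee_fin expR_ge0.
apply: (small_slope_sum sym star w0 tail_w tail_u betaE) => //.
- exact: cvx_addr.
- by have [m hm] := fb; exists (m - f (- (32 * w))) => x; rewrite lerD2r.
- by move=> x y xy; rewrite lerD2r fmon.
- by rewrite subrr.
Qed.

End monotone_ic.

(** * The inequality on the line *)

(* With [s = 1 - bp] and [t = 1 - bm], this is the superadditivity of
   [s |-> s / (1 - s)]. *)
Lemma mule_le1_superadd {R : realType} (a ap am b bp bm : \bar R) :
  (0 <= a)%E -> (0 <= b)%E -> (0 <= bp <= 1)%E -> (0 <= bm <= 1)%E ->
  (0 <= ap)%E -> (0 <= am)%E -> (a + 1 <= ap + am)%E -> (b + 1 = bp + bm)%E ->
  (ap * bp <= 1)%E -> (am * bm <= 1)%E -> (a * b <= 1)%E.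
Proof.
case: bp => [p| |]; case: bm => [q| |];
  try by [move=> _ _ /andP[]|move=> _ _ _ /andP[]].
  case: b => [b| |]//; rewrite ?lee_fin => a0 b0 p01 q01 ap0 am0 aD [bD] app amq.
  have [b00|b1] := eqVneq b 0; first by rewrite b00 mule0.
  have {}b1 : 0 < b by rewrite lt_neqAle eq_sym b1.
  have p0 : 0 < p by lra.
  have q0 : 0 < q by lra.
  move: app amq aD.
  case: ap ap0 => [x| |]// x0; last by rewrite mulyr gtr0_sg// mul1e.
  case: am am0 => [y| |]// y0; last by rewrite mulyr gtr0_sg// mul1e.
  case: a a0 => [a| |]//; rewrite -?EFinM -?EFinD !lee_fin => a0 xp yq aD.
  rewrite lee_fin in x0; rewrite lee_fin in y0.
  have xp1 : x <= p^-1 by rewrite -[p^-1]mul1r ler_pdivlMr.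
  have yq1 : y <= q^-1 by rewrite -[q^-1]mul1r ler_pdivlMr.
  apply: (@le_trans _ _ ((p^-1 + q^-1 - 1) * (p + q - 1))).
    by apply: ler_pM => //; lra.
  have -> : (p^-1 + q^-1 - 1) * (p + q - 1) =
      1 - (p + q) * ((1 - p) * (1 - q)) / (p * q).
    by field; apply/andP; split; rewrite gt_eqF.
  rewrite gerBl divr_ge0// ?mulr_ge0//; lra.
Qed.

Section convex_ic.
Context {R : realType} (mu : probability (measurableTypeR R) R).
Local Notation T := (measurableTypeR R).
Local Notation tail := (tail mu).
Hypotheses (sym : symmetric_measure mu) (star : star_tail mu).
Variable beta : R.
Hypothesis betaE : beta = 60 * 56.
Local Notation C := (cost mu beta : R^o -> R -> Prop).

Let cC : convex_cost C := convex_cost_rate sym beta^-1.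

(** A convex function that descends somewhere and ascends somewhere stays above its earlier values
    outside a compact interval, on which the minimum is attained. *)
Lemma cvx_min (f : R -> R) : cvx (f : R^o -> R) ->
  [\/ {homo f : x y / x <= y}, {homo f : x y /~ x <= y} |
      exists x0, forall x, f x0 <= f x].
Proof.
move=> cf.
have [inc|ninc] := pselect {homo f : x y / x <= y}; first exact: Or31.
have [dec|ndec] := pselect {homo f : x y /~ x <= y}; first exact: Or32.
apply: Or33.
have [p [q [pq fpq]]] : exists p q, p < q /\ f q < f p.
  apply: contrapT => H; apply: ninc => x y; rewrite le_eqVlt => /predU1P[->//|xy].
  by rewrite leNgt; apply/negP => h; apply: H; exists x, y.
have [r [s [rs frs]]] : exists r s, r < s /\ f r < f s.
  apply: contrapT => H; apply: ndec => y x; rewrite le_eqVlt => /predU1P[->//|xy].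
  by rewrite leNgt; apply/negP => h; apply: H; exists x, y.
have left x : x < p -> f p <= f x.
  move=> xp; rewrite leNgt; apply/negP => h.
  by have := cvx_slopes cf xp pq; nra.
have right x : s < x -> f s <= f x.
  move=> sx; rewrite leNgt; apply/negP => h.
  by have := cvx_slopes cf rs sx; nra.
pose a := Num.min p r; pose b := Num.max q s.
have ap : a <= p by rewrite ge_min lexx.
have ar : a <= r by rewrite ge_min lexx orbT.
have bq : q <= b by rewrite le_max lexx.
have bs : s <= b by rewrite le_max lexx orbT.
have ab : a <= b by lra.
have [x0] := EVT_min ab (continuous_subspaceT (cvx_real_continuous cf)).
rewrite in_itv/= => x0ab x0min; exists x0 => x.
have [xa|xa] := ltP x a.
  apply: (@le_trans _ _ (f p)); last by apply: left; lra.
  by apply: x0min; rewrite in_itv/=; lra.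
have [xb|xb] := ltP b x.
  apply: (@le_trans _ _ (f s)); last by apply: right; lra.
  by apply: x0min; rewrite in_itv/=; lra.
by apply: x0min; rewrite in_itv/= xa.
Qed.

(** In the application [u] is the infimum convolution, [v] is [- f], and the others come from the
    two pieces of [f] cut at its minimum 0. At each point one piece is 0, whence the 1; for the
    infimum convolutions, which are nonnegative, it is only a lower bound. *)
Lemma product_split (u up um v vp vm : T -> R) :
  let E (h : T -> R) := fun x : T => (expR (h x))%:E in
  measurable_fun setT (E u) -> measurable_fun setT (E up) -> measurable_fun setT (E um) ->
  measurable_fun setT (E v) -> measurable_fun setT (E vp) -> measurable_fun setT (E vm) ->
  (forall x, expR (u x) + 1 <= expR (up x) + expR (um x)) ->
  (forall x, expR (v x) + 1 = expR (vp x) + expR (vm x)) ->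
  (forall x, vp x <= 0) -> (forall x, vm x <= 0) ->
  (\int[mu]_x E up x * \int[mu]_x E vp x <= 1)%E ->
  (\int[mu]_x E um x * \int[mu]_x E vm x <= 1)%E ->
  (\int[mu]_x E u x * \int[mu]_x E v x <= 1)%E.
Proof.
move=> E mu_ mup mum mv mvp mvm uD vD vp0 vm0.
have E0 h x : (0 <= E h x)%E by rewrite lee_fin expR_ge0.
have one : (\int[mu]_x (cst 1 x : \bar R) = 1)%E.
  by rewrite integral_cst//= probability_setT mule1.
have addone (g : T -> \bar R) : measurable_fun setT g -> (forall x, (0 <= g x)%E) ->
    (\int[mu]_x g x + 1 = \int[mu]_x (g x + cst 1 x))%E.
  by move=> mg g0; rewrite ge0_integralD// one.
have le1 h : measurable_fun setT (E h) -> (forall x, h x <= 0) ->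
    (0 <= \int[mu]_x E h x <= 1)%E.
  move=> mh h0; rewrite integral_ge0//= -one; apply: ge0_le_integral => //.
  by move=> x _; rewrite lee_fin expR_le1.
apply: mule_le1_superadd => //.
- exact: integral_ge0.
- exact: integral_ge0.
- exact: le1.
- exact: le1.
- exact: integral_ge0.
- exact: integral_ge0.
- rewrite addone// -ge0_integralD//.
  apply: ge0_le_integral => //.
  + by move=> x _; rewrite adde_ge0.
  + exact: emeasurable_funD.
  + exact: emeasurable_funD.
  by move=> x _; rewrite -!EFinD lee_fin.
- rewrite addone// -ge0_integralD//.
  by apply: eq_integral => x _; rewrite -!EFinD; congr EFin.
Qed.

Let costN h r : C h r -> C (- h) r.
Proof. by apply: cost_mono => //; rewrite normrN. Qed.

Lemma infc_opp (f : R -> R) x : (exists m, forall x, m <= f x) ->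
  infc C (fun y : R^o => f (- y)) x = infc C (f : R^o -> R) (- x).
Proof.
move=> fb; have fNb : exists m, forall x, m <= f (- x).
  by have [m hm] := fb; exists m.
apply/eqP; rewrite eq_le; apply/andP; split.
  apply: infc_ge => // h r /costN hr; have := infc_le cC fNb x hr.
  by rewrite opprK opprD.
apply: infc_ge => // h r /costN hr; have := infc_le cC fb (- x) hr.
by rewrite opprK opprB [- x + h]addrC.
Qed.

Section fixed_scale.
Variable w : R.
Hypotheses (w0 : 0 < w) (tail_w : tail w <= expR (-1)) (tail_u : expR (-1) <= tail (w / 4)).

Let ic_mono (f : R -> R) : cvx (f : R^o -> R) -> (exists m, forall x, m <= f x) ->
  {homo f : x y / x <= y} ->
  (\int[mu]_x (expR (infc C (f : R^o -> R) x))%:E * \int[mu]_x (expR (- f x))%:E <= 1)%E.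
Proof. exact: (ic_monotone sym star w0 tail_w tail_u betaE). Qed.

Let ic_anti (f : R -> R) : cvx (f : R^o -> R) -> (exists m, forall x, m <= f x) ->
  {homo f : x y /~ x <= y} ->
  (\int[mu]_x (expR (infc C (f : R^o -> R) x))%:E * \int[mu]_x (expR (- f x))%:E <= 1)%E.
Proof.
move=> cf fb fmon.
have cfN : cvx ((fun x => f (- x)) : R^o -> R).
  move=> l x y l01; have := cf l (- x) (- y) l01.
  by rewrite /GRing.scale/= !mulrN -opprD.
have fNb : exists m, forall x, m <= f (- x) by have [m hm] := fb; exists m.
have fNmon : {homo (fun x => f (- x)) : x y / x <= y}.
  by move=> x y xy; apply: fmon; rewrite lerN2.
have := ic_mono cfN fNb fNmon.
under eq_integral do rewrite infc_opp//.
rewrite (symmetric_integral sym (measurable_expR_infc cC cf fb)); last first.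
  by move=> x; rewrite lee_fin expR_ge0.
by rewrite (symmetric_integral sym (measurable_expRN_cvx cf)).
Qed.

Let ic_min0 (f : R -> R) x0 : cvx (f : R^o -> R) -> f x0 = 0 -> (forall x, 0 <= f x) ->
  (\int[mu]_x (expR (infc C (f : R^o -> R) x))%:E * \int[mu]_x (expR (- f x))%:E <= 1)%E.
Proof.
move=> cf f0 fge.
have cfR l x y : 0 <= l <= 1 -> f (l * x + (1 - l) * y) <= l * f x + (1 - l) * f y.
  exact: cf.
have scaled l x : 0 <= l <= 1 -> f (l * x + (1 - l) * x0) <= f x.
  move=> l01; apply: le_trans (cfR l x x0 l01) _; rewrite f0; have := fge x; nra.
have scalar x y : x0 < y -> x0 <= x <= y -> exists2 l, 0 <= l <= 1 & x = l * y + (1 - l) * x0.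
  move=> xy xyx; exists ((x - x0) / (y - x0)).
    by rewrite ler_pdivrMr ?ler_pdivlMr; lra.
  by field; rewrite gt_eqF//; lra.
have scalar' x y : y < x0 -> y <= x <= x0 -> exists2 l, 0 <= l <= 1 & x = l * y + (1 - l) * x0.
  move=> xy xyx; exists ((x0 - x) / (x0 - y)).
    by rewrite ler_pdivrMr ?ler_pdivlMr; lra.
  by field; rewrite gt_eqF//; lra.
have finc x y : x0 <= x -> x <= y -> f x <= f y.
  move=> x0x xy; have [yx0|x0y] := leP y x0.
    by have -> : x = y by apply/eqP; rewrite eq_le xy; lra.
  by have [|l l01 ->] := scalar x y x0y; [rewrite x0x|exact: scaled].
have fdec x y : x <= y -> y <= x0 -> f y <= f x.
  move=> xy yx0; have [x0x|xx0] := leP x0 x.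
    by have -> : x = y by apply/eqP; rewrite eq_le xy; lra.
  by have [|l l01 ->] := scalar' y x xx0; [rewrite xy|exact: scaled].
pose fp x := f (Num.max x x0); pose fm x := f (Num.min x x0).
have maxl x : x0 <= Num.max x x0 by rewrite le_max lexx orbT.
have minl x : Num.min x x0 <= x0 by rewrite ge_min lexx orbT.
have fpr x : x0 <= x -> fp x = f x by move=> h; rewrite /fp (max_idPl h).
have fpl x : x <= x0 -> fp x = 0 by move=> h; rewrite /fp (max_idPr h) f0.
have fml x : x <= x0 -> fm x = f x by move=> h; rewrite /fm (min_idPl h).
have fmr x : x0 <= x -> fm x = 0 by move=> h; rewrite /fm (min_idPr h) f0.
have cfp : cvx (fp : R^o -> R).
  move=> l x y l01; apply: le_trans (cfR l (Num.max x x0) (Num.max y x0) l01).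
  apply: finc => //; rewrite ge_max /GRing.scale/=.
  have hx : x <= Num.max x x0 by rewrite le_max lexx.
  have hy : y <= Num.max y x0 by rewrite le_max lexx.
  have := maxl x; have := maxl y; move: hx hy.
  by set u := Num.max x x0; set v := Num.max y x0 => *; apply/andP; split; nra.
have cfm : cvx (fm : R^o -> R).
  move=> l x y l01; apply: le_trans (cfR l (Num.min x x0) (Num.min y x0) l01).
  apply: fdec => //; rewrite le_min /GRing.scale/=.
  have hx : Num.min x x0 <= x by rewrite ge_min lexx.
  have hy : Num.min y x0 <= y by rewrite ge_min lexx.
  have := minl x; have := minl y; move: hx hy.
  by set u := Num.min x x0; set v := Num.min y x0 => *; apply/andP; split; nra.
have fb : exists m, forall x, m <= f x by exists 0.
have fpb : exists m, forall x, m <= fp x by exists 0 => x; exact: fge.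
have fmb : exists m, forall x, m <= fm x by exists 0 => x; exact: fge.
have fpmon : {homo fp : x y / x <= y}.
  by move=> x y xy; apply: finc => //; rewrite ge_max maxl andbT le_max xy.
have fmmon : {homo fm : x y /~ x <= y}.
  by move=> x y xy; apply: fdec => //; rewrite le_min minl andbT ge_min xy.
(* A jump that passes [x0] may be stopped there: it gets shorter, hence no more costly, and ends at
   the minimum of [f]. *)
have Qp x : x0 <= x -> infc C (f : R^o -> R) x <= infc C (fp : R^o -> R) x.
  move=> x0x; apply: infc_ge => // h r hr.
  have [xh|xh] := leP x0 (x - h); first by rewrite fpr//; exact: infc_le.
  rewrite (fpl _ (ltW xh)) -f0.
  have := @infc_le _ _ C f cC fb x (x - x0) r; rewrite subKr; apply.
  by apply: cost_mono hr => //; rewrite !ger0_norm; lra.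
have Qm x : x <= x0 -> infc C (f : R^o -> R) x <= infc C (fm : R^o -> R) x.
  move=> x0x; apply: infc_ge => // h r hr.
  have [xh|xh] := leP (x - h) x0; first by rewrite fml//; exact: infc_le.
  rewrite (fmr _ (ltW xh)) -f0.
  have := @infc_le _ _ C f cC fb x (x - x0) r; rewrite subKr; apply.
  by apply: cost_mono hr => //; rewrite !ler0_norm; lra.
apply: product_split (ic_mono cfp fpb fpmon) (ic_anti cfm fmb fmmon).
- exact: measurable_expR_infc.
- exact: measurable_expR_infc.
- exact: measurable_expR_infc.
- exact: measurable_expRN_cvx.
- exact: measurable_expRN_cvx.
- exact: measurable_expRN_cvx.
- move=> x; have [x0x|xx0] := leP x0 x.
    apply: lerD; first by rewrite ler_expR Qp.
    by rewrite -expR0 ler_expR; apply: infc_lb => // y; exact: fge.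
  rewrite [leRHS]addrC; apply: lerD; first by rewrite ler_expR Qm// ltW.
  by rewrite -expR0 ler_expR; apply: infc_lb => // y; exact: fge.
- move=> x; have [x0x|xx0] := leP x0 x.
    by rewrite (fpr _ x0x) (fmr _ x0x) oppr0 expR0.
  by rewrite (fpl _ (ltW xx0)) (fml _ (ltW xx0)) oppr0 expR0 addrC.
- by move=> x; rewrite oppr_le0; exact: fge.
- by move=> x; rewrite oppr_le0; exact: fge.
Qed.

Lemma ic_fixed_scale (f : R -> R) : cvx (f : R^o -> R) -> (exists m, forall x, m <= f x) ->
  (\int[mu]_x (expR (infc C (f : R^o -> R) x))%:E * \int[mu]_x (expR (- f x))%:E <= 1)%E.
Proof.
move=> cf fb; have [inc|dec|[x0 x0min]] := cvx_min cf.
- exact: ic_mono.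
- exact: ic_anti.
rewrite -(ic_prod_addr mu cC cf fb (- f x0)); apply: (@ic_min0 _ x0).
- exact: cvx_addr.
- by rewrite subrr.
- by move=> x; rewrite subr_ge0.
Qed.

End fixed_scale.

Lemma tail_cvg0 e : 0 < e -> exists2 n : nat, (0 < n)%N & tail n%:R < e.
Proof.
move=> e0; pose F (n : nat) : set T := [set x : R | n.+1%:R <= `|x|].
have mF n : measurable (F n) by exact: measurable_abs_ge.
have F0 : \bigcap_n F n = set0.
  apply/seteqP; split => // x Fx.
  have /andP[_ h] := truncn_itv (normr_ge0 x).
  by have := Fx (Num.truncn `|x|) I; rewrite /F/= leNgt h.
have cv : (mu \o F) n @[n --> \oo] --> mu (\bigcap_n F n).
  apply: nonincreasing_cvg_mu => //.
  - by rewrite ltey_eq fin_num_measure.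
  - exact: bigcap_measurable.
  - move=> n m nm; rewrite subsetEset => x; rewrite /F/=; apply: le_trans.
    by rewrite ler_nat ltnS.
rewrite F0 measure0 in cv.
have /fine_cvgP[_ /cvgrPdist_lt/(_ e e0)[N _ /(_ N (leqnn N))]] := cv.
rewrite sub0r normrN ger0_norm ?fine_ge0// => h.
by exists N.+1.
Qed.

(** The scale [w] is the first [4 ^+ n * (l * t)] whose tail is below [1/e], so that [w / 4] is the
    preceding one. The ratio [l] is chosen for [l ln (tail t) >= -1], which makes the initial tail
    at least [1/e]. *)
Lemma scale_exists t : 0 < t -> 0 < tail t ->
  exists w, [/\ 0 < w, tail w <= expR (-1) & expR (-1) <= tail (w / 4)].
Proof.
move=> t0 S0.
have l0 : ln (tail t) <= 0 by rewrite ln_le0// tail_le1.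
pose l := (1 - ln (tail t))^-1.
have d0 : 0 < 1 - ln (tail t) by lra.
have l01 : 0 <= l <= 1.
  by rewrite /l invr_ge0 (ltW d0)/= invf_le1//; lra.
have lp : 0 < l by rewrite /l invr_gt0.
pose s (n : nat) := 4 ^+ n * (l * t).
have s0 n : 0 < s n by rewrite /s mulr_gt0 ?exprn_gt0// mulr_gt0.
have c0 : expR (-1) <= tail (s 0%N).
  rewrite /s expr0 mul1r; apply: le_trans (star (ltW t0) l01 S0).
  rewrite ler_expR /l mulrC ler_pdivlMr//; lra.
have exn : exists n, tail (s n) < expR (-1).
  have [N N0 hN] := tail_cvg0 (expR_gt0 (-1)).
  have h : 0 <= N%:R / (l * t) by rewrite divr_ge0// ltW// mulr_gt0.
  exists (Num.truncn (N%:R / (l * t))).+1; apply: le_lt_trans hN; apply: tail_anti.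
  have /andP[_] := truncn_itv h; set k := (Num.truncn _).+1.
  rewrite ltr_pdivrMr ?mulr_gt0// => h2; apply: le_trans (ltW h2) _.
  by rewrite /s ler_pM2r ?mulr_gt0// -natrX ler_nat ltnW// ltn_expl.
case: (ex_minnP exn) => -[|n]; first by rewrite ltNge c0.
move=> hn minn; exists (s n.+1); split => //; first exact: ltW.
have -> : s n.+1 / 4 = s n by rewrite /s exprS; field.
by rewrite leNgt; apply/negP => /minn; rewrite ltnn.
Qed.

(** The variable is 0 almost surely and there is no scale [w]; the inequality reduces to
    [infc C f 0 <= f 0]. *)
Lemma ic_degenerate (f : R -> R) : (forall t, 0 < t -> tail t = 0) ->
  cvx (f : R^o -> R) -> (exists m, forall x, m <= f x) ->
  (\int[mu]_x (expR (infc C (f : R^o -> R) x))%:E * \int[mu]_x (expR (- f x))%:E <= 1)%E.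
Proof.
move=> S0 cf fb.
pose F (n : nat) : set T := [set x : R | n.+1%:R^-1 <= `|x|].
have N0 : mu.-negligible (\bigcup_n F n).
  apply: negligible_bigcup => n; exists (F n); split => //.
  - exact: measurable_abs_ge.
  - transitivity (tail n.+1%:R^-1)%:E; first exact: tailE.
    by rewrite S0// invr_gt0.
have ae0 (g : T -> R) : measurable_fun setT (fun x : T => (expR (g x))%:E) ->
    (\int[mu]_x (expR (g x))%:E = (expR (g 0))%:E)%E.
  move=> mg; transitivity (\int[mu]_x cst (expR (g 0))%:E x)%E.
    apply: ge0_ae_eq_integral => //.
      by move=> x _; rewrite lee_fin expR_ge0.
    apply: negligibleS N0 => x /= h.
    have x0 : x != 0 by apply/eqP => x0; apply: h; rewrite x0.
    have xp : 0 < `|x| by rewrite normr_gt0.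
    have [n hn] := ltr_add_invr xp; exists n => //.
    by rewrite /F/=; move: hn; rewrite add0r => /ltW.
  by rewrite integral_cst//= probability_setT mule1.
rewrite ae0 ?(ae0 (fun x => - f x)).
- rewrite -EFinM -expRD lee_fin expR_le1 subr_le0.
  exact: infc_le_id.
- exact: measurable_expRN_cvx.
- exact: measurable_expR_infc.
Qed.

Theorem ic_real (f : R -> R) : cvx (f : R^o -> R) -> (exists m, forall x, m <= f x) ->
  (\int[mu]_x (expR (infc C (f : R^o -> R) x))%:E * \int[mu]_x (expR (- f x))%:E <= 1)%E.
Proof.
move=> cf fb.
have [[t [t0 S0]]|deg] := pselect (exists t, 0 < t /\ 0 < tail t).
  have [w [w0 h1 h2]] := scale_exists t0 S0.
  exact: (ic_fixed_scale w0 h1 h2).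
apply: ic_degenerate => // t t0; apply/eqP; rewrite eq_le tail_ge0 andbT leNgt.
by apply/negP => S0; apply: deg; exists t.
Qed.

End convex_ic.

(** * Tensorization *)

Section borel_vectors.
Context {R : realType}.

Definition rbox n (B : 'I_n -> set R) : set 'rV[R]_n :=
  [set v | forall i, B i (v ord0 i)].

Definition ratbox n (c : {ffun 'I_n -> rat * rat}) : set 'rV[R]_n :=
  rbox (fun i => `]ratr (c i).1, ratr (c i).2[%classic).

(** A rational box fits around each point of [A]; boxes not contained in [A] are replaced by the
    empty set, so that the union runs over a countable type. *)
Lemma open_rbox_cover n (A : set 'rV[R]_n) : open A ->
  A = \bigcup_c (if `[< @ratbox n c `<=` A >] then ratbox c else set0).
Proof.
move=> oA; apply/seteqP; split => v; last first.
  by move=> [c _]; case: asboolP => // sub /sub.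
move=> Av; have /nbhs_ballP[e /= e0 sub] : nbhs v A by apply: open_nbhs_nbhs.
have /fin_all_exists[c hc] : forall i : 'I_n, exists q : rat * rat,
    [/\ v ord0 i - e < ratr q.1, ratr q.1 < v ord0 i, v ord0 i < ratr q.2
      & ratr q.2 < v ord0 i + e].
  move=> i; have [|q] := @rat_in_itvoo R (v ord0 i - e) (v ord0 i); first by lra.
  have [|q'] := @rat_in_itvoo R (v ord0 i) (v ord0 i + e); first by lra.
  by rewrite !in_itv/= => /andP[? ?] /andP[? ?]; exists (q, q').
exists [ffun i => c i] => //; case: asboolP.
  by move=> _ i; rewrite ffunE/= in_itv/=; have [_ -> ->] := hc i.
case=> u hu; apply: sub; split => // i j; rewrite ord1.
have := hu j; have [h1 _ _ h2] := hc j; rewrite /= ffunE in_itv/= => /andP[h3 h4].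
rewrite /ball/= ltr_norml; apply/andP; split; lra.
Qed.

Lemma measurable_coord n (i : 'I_n) :
  measurable_fun [set: borel_rV R n] (fun v : borel_rV R n => (v : 'rV[R]_n) ord0 i).
Proof.
apply: measurable_fun_lt => t; apply: sub_sigma_algebra.
by apply: (@open_comp _ _ (fun v : 'rV[R]_n => v ord0 i) [set x | x < t]) => [v _|];
  [exact: coord_continuous|exact: open_lt].
Qed.

Lemma measurable_rbox n (B : 'I_n -> set R) : (forall i, measurable (B i)) ->
  measurable (rbox B : set (borel_rV R n)).
Proof.
move=> mB.
have -> : rbox B = \bigcap_(i in [set: 'I_n])
    ((fun v : borel_rV R n => (v : 'rV[R]_n) ord0 i) @^-1` B i).
  by apply/seteqP; split => [v h i _|v h i]; exact: h.
apply: fin_bigcap_measurable => // i _; rewrite -[X in measurable X]setTI.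
exact: measurable_coord.
Qed.

Definition rboxes n : set (set 'rV[R]_n) :=
  [set A | exists B, (forall i, measurable (B i)) /\ A = rbox B].

(** Every open set is a countable union of rational boxes. Hence measurability into [R^n] can be
    tested coordinatewise, and equality of finite measures on boxes. *)
Lemma measurable_rboxes n :
  (@measurable _ (borel_rV R n)) = <<s @rboxes n >>.
Proof.
apply/seteqP; split => [A|]; last first.
  apply: smallest_sub; first exact: sigma_algebra_measurable.
  by move=> _ [B [mB ->]]; exact: measurable_rbox.
apply: smallest_sub; first exact: smallest_sigma_algebra.
move=> {}A oA; rewrite (open_rbox_cover oA).
apply: (@countable_bigcupT_measurable _ (g_sigma_algebraType (@rboxes n))).
  exact: countableP.
move=> c; case: asboolP => _; last exact: measurable0.
by apply: sub_sigma_algebra; exists (fun i => `]ratr (c i).1, ratr (c i).2[%classic).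
Qed.

Lemma measurable_to_rV d (U : measurableType d) n (g : U -> borel_rV R n) :
  (forall i, measurable_fun setT (fun w => (g w : 'rV[R]_n) ord0 i)) ->
  measurable_fun setT g.
Proof.
move=> mg; apply: (@measurability _ _ _ _ setT g (@rboxes n) (measurable_rboxes n)).
move=> _ [_ [B [mB ->]] <-]; rewrite setTI.
have -> : g @^-1` rbox B = \bigcap_(i in [set: 'I_n])
    ((fun w => (g w : 'rV[R]_n) ord0 i) @^-1` B i).
  by apply/seteqP; split => [v h i _|v h i]; exact: h.
apply: fin_bigcap_measurable => // i _; rewrite -[X in measurable X]setTI.
exact: mg.
Qed.

Lemma measure_eq_rbox n (m1 m2 : {measure set (borel_rV R n) -> \bar R}) :
  (m1 setT < +oo)%E ->
  (forall B, (forall i, measurable (B i)) -> m1 (rbox B) = m2 (rbox B)) ->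
  forall A : set (borel_rV R n), measurable A -> m1 A = m2 A.
Proof.
move=> fin H A; apply: (@measure_unique _ R (borel_rV R n) (@rboxes n) (fun=> setT)).
- exact: measurable_rboxes.
- move=> _ _ [B [mB ->]] [B' [mB' ->]]; exists (fun i => B i `&` B' i); split.
    by move=> i; exact: measurableI.
  by apply/seteqP; split => [v [h h'] i|v h]; [split|split => i; have [] := h i].
- by move=> _; exists (fun=> setT); split => //; apply/seteqP; split.
- by apply/seteqP; split => // v _; exists 0%N.
- by move=> _ [B [mB ->]]; exact: H.
- by [].
Qed.

End borel_vectors.

Section independence.
Context {R : realType} d (T : measurableType d) (P : probability T R).

Definition rvec n (Y : 'I_n -> T -> R) (w : T) : borel_rV R n :=
  \row_i Y i w.

(** Subfamilies correspond to taking [B i = setT] for the other indices. *)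
Definition mutually_independent n (Y : 'I_n -> T -> R) :=
  forall B : 'I_n -> set R, (forall i, measurable (B i)) ->
    P (rvec Y @^-1` rbox B) = (\prod_i P (Y i @^-1` B i))%E.

Definition consr n (x : R) (y : 'rV[R]_n) : 'rV[R]_n.+1 :=
  \row_i (if unlift ord0 i is Some j then y ord0 j else x).

Lemma consr0 n (x : R) (y : 'rV[R]_n) : consr x y ord0 ord0 = x.
Proof. by rewrite mxE unlift_none. Qed.

Lemma consr_lift n (x : R) (y : 'rV[R]_n) j : consr x y ord0 (lift ord0 j) = y ord0 j.
Proof. by rewrite mxE liftK. Qed.

Lemma consr_conv n l (x x' : R) (y y' : 'rV[R]_n) :
  consr (l * x + (1 - l) * x') (l *: y + (1 - l) *: y') =
  l *: consr x y + (1 - l) *: consr x' y'.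
Proof. by apply/rowP => i; rewrite !mxE; case: unliftP => [j _|_]; rewrite ?mxE. Qed.

Lemma consrB n (x x' : R) (y y' : 'rV[R]_n) :
  consr x y - consr x' y' = consr (x - x') (y - y').
Proof. by apply/rowP => i; rewrite !mxE; case: unliftP => [j _|_]; rewrite ?mxE. Qed.

Lemma measurable_rvec n (Y : 'I_n -> T -> R) :
  (forall i, measurable_fun setT (Y i)) -> measurable_fun setT (rvec Y).
Proof.
move=> mY; apply: measurable_to_rV => i.
by apply: eq_measurable_fun (mY i) => w _; rewrite mxE.
Qed.

Lemma mutually_independent_tail n (Y : 'I_n.+1 -> T -> R) :
  mutually_independent Y -> mutually_independent (fun j => Y (lift ord0 j)).
Proof.
move=> H B mB.
have := H (fun i => if unlift ord0 i is Some j then B j else setT).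
rewrite big_ord_recl unlift_none preimage_setT probability_setT mul1e.
under eq_bigr do rewrite liftK.
move=> <-; last by move=> i; case: unliftP => [j _|_].
congr (P _); apply/seteqP; split => w h i /=.
  by case: unliftP => [j ->|//]; have := h j; rewrite !mxE.
by have := h (lift ord0 i); rewrite /= liftK !mxE.
Qed.

(* The first coordinate is replaced by an independent copy, so that the
   remaining ones can be frozen. *)
Lemma integral_decouple n (Y : 'I_n.+1 -> T -> R) (g : borel_rV R n.+1 -> \bar R) :
  (forall i, measurable_fun setT (Y i)) -> mutually_independent Y ->
  measurable_fun setT g -> (forall v, (0 <= g v)%E) ->
  (\int[P]_w g (rvec Y w) =
   \int[P]_w' \int[P]_w g (consr (Y ord0 w) (rvec (fun j => Y (lift ord0 j)) w')))%E.
Proof.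
move=> mY iY mg g0.
pose Z j := Y (lift ord0 j).
pose psi (p : T * T) : borel_rV R n.+1 := consr (Y ord0 p.1) (rvec Z p.2).
have mpsi : measurable_fun setT psi.
  apply: measurable_to_rV => i; have [j ->|->] := unliftP ord0 i.
    apply: (@eq_measurable_fun _ _ _ _ _ (fun p : T * T => Z j p.2)).
      by move=> p _; rewrite consr_lift mxE.
    by apply: (measurableT_comp (mY (lift ord0 j))); exact: measurable_snd.
  apply: (@eq_measurable_fun _ _ _ _ _ (fun p : T * T => Y ord0 p.1)).
    by move=> p _; rewrite consr0.
  by apply: (measurableT_comp (mY ord0)); exact: measurable_fst.
have mr := measurable_rvec mY.
have mZ : measurable_fun setT (rvec Z) by apply: measurable_rvec => j; exact: mY.
pose m1 : {measure set (borel_rV R n.+1) -> \bar R} :=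
  measure_function_pushforward__canonical__measure_function_Measure P mr.
pose m2 : {measure set (borel_rV R n.+1) -> \bar R} :=
  measure_function_pushforward__canonical__measure_function_Measure (P \x P)%E mpsi.
have E : forall A : set (borel_rV R n.+1), measurable A -> m1 A = m2 A.
  apply: measure_eq_rbox.
    by rewrite /m1/= /pushforward preimage_setT probability_setT ltry.
  move=> B mB; rewrite /m1 /m2/= /pushforward.
  rewrite [LHS](iY B mB) big_ord_recl.
  rewrite -(mutually_independent_tail iY (fun j => mB (lift ord0 j))).
  rewrite -product_measure1E; last 2 first.
  - by rewrite -[X in measurable X]setTI; exact: mY.
  - rewrite -[X in measurable X]setTI; apply: mZ => //.
    by apply: measurable_rbox => j; exact: mB.
  congr ((P \x P)%E _); apply/seteqP; split => p.
    move=> [h1 h2] i; rewrite /= /psi; have [j ->|->] := unliftP ord0 i.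
      by rewrite consr_lift; exact: h2.
    by rewrite consr0.
  move=> h; split.
    by have := h ord0; rewrite /= /psi consr0.
  by move=> j; have := h (lift ord0 j); rewrite /= /psi consr_lift.
transitivity (\int[m1]_v g v)%E.
  by rewrite /m1 ge0_integral_pushforward.
transitivity (\int[m2]_v g v)%E.
  by apply: eq_measure_integral => A mA _; exact: E.
rewrite /m2 ge0_integral_pushforward//= preimage_setT.
by rewrite fubini_tonelli2//; exact: measurableT_comp.
Qed.

End independence.

Section monotone_integral.
Context {R : realType} d (T : measurableType d) (P : probability T R).

(** The integral of a nonnegative function is a supremum over the simple functions below it. This
    form serves where measurability is not at hand, as for [expeR (infconv f phi (X w))]. *)
Lemma ge0_le_integral_any (f g : T -> \bar R) : (forall w, (0 <= f w)%E) ->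
  (forall w, (f w <= g w)%E) -> (\int[P]_w f w <= \int[P]_w g w)%E.
Proof.
move=> f0 fg; have g0 w : (0 <= g w)%E := le_trans (f0 w) (fg w).
rewrite !ge0_integralTE//; apply: ereal_sup_le => _ [h hf <-].
by exists h => // w; exact: le_trans (hf w) (fg w).
Qed.

Lemma integral_expR_gt0 (g : T -> R) : measurable_fun setT g ->
  (0 < \int[P]_w (expR (g w))%:E)%E.
Proof.
move=> mg; rewrite lt0e; apply/andP; split; last first.
  by apply: integral_ge0 => w _; rewrite lee_fin expR_ge0.
apply/eqP => I0.
have mE : measurable_fun setT (fun w => (expR (g w))%:E).
  by apply/measurable_EFinP; exact: measurableT_comp.
have : (\int[P]_w `|(expR (g w))%:E| = 0)%E.
  by rewrite -I0; apply: eq_integral => w _; rewrite gee0_abs// lee_fin expR_ge0.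
move=> /(ae_eq_integral_abs _ measurableT mE)[N [mN N0 sub]].
have : P setT = 0.
  apply: (subset_measure0 _ mN) => // w _; apply: sub => /= h.
  by have := h I => -[] /eqP; rewrite gt_eqF// expR_gt0.
by move/eqP; rewrite probability_setT; apply/negP; rewrite oner_neq0.
Qed.

Lemma integral_conv (g h : T -> \bar R) (l : R) : 0 <= l <= 1 ->
  (forall w, (0 <= g w)%E) -> (forall w, (0 <= h w)%E) ->
  measurable_fun setT g -> measurable_fun setT h ->
  (\int[P]_w g w = 1)%E -> (\int[P]_w h w = 1)%E ->
  (\int[P]_w (l%:E * g w + (1 - l)%:E * h w) = 1)%E.
Proof.
move=> /andP[l0 l1] g0 h0 mg mh Ig Ih; have l1' : 0 <= 1 - l by rewrite subr_ge0.
rewrite ge0_integralD//; last 4 first.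
- by move=> w _; rewrite mule_ge0 ?lee_fin.
- exact: measurable_funeM.
- by move=> w _; rewrite mule_ge0 ?lee_fin.
- exact: measurable_funeM.
rewrite !ge0_integralZl_EFin// Ig Ih !mule1 -EFinD.
by rewrite addrCA subrr addr0.
Qed.

End monotone_integral.

(** * Costs that add over the coordinates *)

Section sum_of_costs.
Context {R : realType}.

Lemma conv_id (V : lmodType R) l (x : V) : l *: x + (1 - l) *: x = x.
Proof. by rewrite -scalerDl addrCA subrr addr0 scale1r. Qed.

(** Relational form of the separable cost [h |-> sum_i phi_i (h_i)], which dominates the Legendre
    transform of a vector with independent coordinates. *)
Definition sum_cost n (C : 'I_n -> R^o -> R -> Prop) (h : 'rV[R]_n) (r : R) :=
  exists rho : 'I_n -> R,
    (forall i, C i (h ord0 i) (rho i)) /\ r = \sum_i rho i.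

Lemma convex_cost_sum n (C : 'I_n -> R^o -> R -> Prop) :
  (forall i, convex_cost (C i)) -> convex_cost (sum_cost C).
Proof.
move=> cC; split.
- by move=> h r [rho [H ->]]; apply: sumr_ge0 => i _; exact: cost_ge0 (cC i) _ _ (H i).
- exists (fun=> 0); split; last by rewrite big1.
  by move=> i; rewrite mxE; exact: cost00.
- move=> l h r h' r' l01 [rho [H ->]] [rho' [H' ->]].
  exists (fun i => l * rho i + (1 - l) * rho' i); split.
    by move=> i; rewrite !mxE; exact: cost_cvx (cC i) _ _ _ _ _ l01 (H i) (H' i).
  by rewrite big_split -!mulr_sumr.
Qed.

Lemma sum_cost_consr n (C : 'I_n.+1 -> R^o -> R -> Prop) h r h' r' :
  C ord0 h r -> sum_cost (fun j => C (lift ord0 j)) h' r' ->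
  sum_cost C (consr h h') (r + r').
Proof.
move=> H [rho [H' ->]].
exists (fun i => if unlift ord0 i is Some j then rho j else r); split.
  by move=> i; rewrite mxE; case: unliftP => [j ->|->].
by rewrite big_ord_recl unlift_none; congr (_ + _); apply: eq_bigr => j _; rewrite liftK.
Qed.

Lemma measurable_infc_rV n (C : 'rV[R]_n -> R -> Prop) f : convex_cost C ->
  (exists m, forall x, m <= f x) -> cvx f ->
  measurable_fun [set: borel_rV R n] (infc C f : borel_rV R n -> R).
Proof.
move=> cC fb cf; apply: measurable_fun_lt => t; apply: sub_sigma_algebra.
have -> : [set x : 'rV[R]_n | infc C f x < t] =
    \bigcup_(p in [set p : 'rV[R]_n * R | C p.1 p.2])
      ((fun x => f (x - p.1)) @^-1` [set y | y < t - p.2]).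
  apply/seteqP; split => x /=.
    by move=> /(infc_lt cC fb)[h [r [hr hx]]]; exists (h, r) => //=; lra.
  move=> [[h r] /= hr hx]; apply: le_lt_trans (infc_le cC fb x hr) _.
  by move: hx; rewrite ltrBrDr.
apply: bigcup_open => -[h r] _ /=.
apply: open_comp => [x _|]; last exact: open_lt.
apply: (@cvx_rV_continuous _ _ (fun x => f (x - h))) => l y z l01.
have := cf l (y - h) (z - h) l01.
by rewrite !scalerBr addrACA -opprD conv_id.
Qed.

End sum_of_costs.

Section tensorization.
Context {R : realType} d (T : measurableType d) (P : probability T R).

Definition ic_ineq (V : lmodType R) (X : T -> V) (C : V -> R -> Prop) :=
  forall f : V -> R, cvx f -> (exists m, forall x, m <= f x) ->
  (\int[P]_w (expR (infc C f (X w)))%:E * \int[P]_w (expR (- f (X w)))%:E <= 1)%E.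

Section partial_infc.
Variables (n : nat) (C0 : R^o -> R -> Prop) (f : 'rV[R]_n.+1 -> R) (m : R).
Hypotheses (cC0 : convex_cost C0) (cf : cvx f) (fm : forall x, m <= f x).

Let slice (y : 'rV[R]_n) : R^o -> R := fun x => f (consr x y).
Let q (x : R) (y : 'rV[R]_n) : R := infc C0 (slice y) x.

Let slice_lb y : exists m, forall x, m <= slice y x.
Proof. by exists m => x; exact: fm. Qed.

Lemma cvx_slice y : cvx (slice y).
Proof.
move=> l x x' l01; have := cf (consr x y) (consr x' y) l01.
by rewrite -consr_conv conv_id.
Qed.

(** Jumps [h] for [y] and [h'] for [y'] combine into one for the convex combination, as [f] is
    jointly convex and [C0] convex. The infimum need not be attained, hence the slack [e]. *)
Lemma partial_infc_conv l x y y' : 0 <= l <= 1 ->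
  q x (l *: y + (1 - l) *: y') <= l * q x y + (1 - l) * q x y'.
Proof.
move=> l01; apply/ler_addgt0Pr => e e0.
have [|h [r [hr H]]] := @infc_lt _ _ _ _ cC0 (slice_lb y) x (q x y + e).
  by rewrite ltrDl.
have [|h' [r' [hr' H']]] := @infc_lt _ _ _ _ cC0 (slice_lb y') x (q x y' + e).
  by rewrite ltrDl.
apply: le_trans (infc_le cC0 (slice_lb _) x (cost_cvx cC0 l01 hr hr')) _.
rewrite /slice /GRing.scale/=.
have -> : x - (l * h + (1 - l) * h') = l * (x - h) + (1 - l) * (x - h') by ring.
rewrite consr_conv.
have := cf (consr (x - h) y) (consr (x - h') y') l01; move: H H'; rewrite /slice.
by move: l01 => /andP[l0 l1]; nra.
Qed.

Variable X : T -> R.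
Hypotheses (mX : measurable_fun setT X) (icX : ic_ineq (X : T -> R^o) C0).

Let A y := (\int[P]_w (expR (q (X w) y))%:E)%E.
Let B y := (\int[P]_w (expR (- f (consr (X w) y)))%:E)%E.
Let F y := ln (fine (A y)).

Let measurable_q y : measurable_fun setT (fun w => q (X w) y).
Proof.
exact: (measurableT_comp (measurable_infc_R cC0 (slice_lb y) (@cvx_slice y)) mX).
Qed.

Let AB y : (A y * B y <= 1)%E.
Proof. exact: (icX (@cvx_slice y) (slice_lb y)). Qed.

Let B_gt0 y : (0 < B y)%E.
Proof.
apply: integral_expR_gt0; apply: measurable_funN.
have cs := cvx_real_continuous (@cvx_slice y).
exact: (measurableT_comp (continuous_measurable_fun cs) mX).
Qed.

Let A_gt0 y : (0 < A y)%E.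
Proof. by apply: integral_expR_gt0; exact: measurable_q. Qed.

(** Since [B y > 0], the one-dimensional inequality forces [A y] to be finite, so that [fine] in [F]
    loses nothing. *)
Let A_lty y : (A y < +oo)%E.
Proof.
rewrite ltNge leye_eq; apply/negP => /eqP Ay.
by have := AB y; rewrite Ay gt0_mulye.
Qed.

Lemma expR_partial y : (expR (F y))%:E = A y.
Proof.
have Af : A y \is a fin_num by rewrite ge0_fin_numE ?A_lty// ltW ?A_gt0.
by rewrite /F lnK ?fineK// posrE fine_gt0// A_gt0 A_lty.
Qed.

Lemma partial_lb y : m <= F y.
Proof.
rewrite -ler_expR -lee_fin expR_partial.
rewrite -[leLHS]mule1 -(probability_setT P) -integral_cst; last exact: measurableT.
apply: ge0_le_integral_any => w; first by rewrite lee_fin expR_ge0.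
by rewrite /= lee_fin ler_expR; apply: infc_lb => // x; exact: fm.
Qed.

(** Hölder's inequality by normalisation: each [e^(q - F)] has integral 1, and convexity of the
    exponential bounds the geometric mean of two of them by their arithmetic mean. *)
Lemma cvx_partial : cvx F.
Proof.
move=> l y y' l01; have [l0 l1] := andP l01.
rewrite -ler_expR -lee_fin expR_partial.
set c := l * F y + (1 - l) * F y'.
pose g z w := expR (q (X w) z - F z).
have g0 z w : (0 <= (g z w)%:E)%E by rewrite lee_fin expR_ge0.
have mg z : measurable_fun setT (fun w => (g z w)%:E).
  apply/measurable_EFinP; apply: measurableT_comp => //.
  by apply: measurable_funB => //; exact: measurable_q.
have Ig z : (\int[P]_w (g z w)%:E = 1)%E.
  rewrite (_ : 1%E = ((expR (- F z))%:E * A z)%E); last first.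
    by rewrite -expR_partial -EFinM -expRD addNr expR0.
  rewrite -ge0_integralZl_EFin ?expR_ge0//; last first.
    by apply/measurable_EFinP; apply: measurableT_comp => //; exact: measurable_q.
  by apply: eq_integral => w _; rewrite -EFinM -expRD /g addrC.
have H w : ((expR (q (X w) (l *: y + (1 - l) *: y')))%:E <=
    (expR c)%:E * (l%:E * (g y w)%:E + (1 - l)%:E * (g y' w)%:E))%E.
  rewrite -(EFinM l) -(EFinM (1 - l)) -EFinD -EFinM lee_fin.
  apply: (@le_trans _ _ (expR c * expR (l * (q (X w) y - F y) + (1 - l) * (q (X w) y' - F y')))).
    rewrite -expRD ler_expR; apply: le_trans (partial_infc_conv _ _ _ l01) _.
    rewrite /c !mulrBr addrACA addrC -addrA.
    by move: (_ * q _ _) (_ * q _ _) (_ * F _) (_ * F _) => a b a' b'; lra.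
  by rewrite ler_wpM2l ?expR_ge0//; exact: cvx_expR.
apply: le_trans (ge0_le_integral_any P _ H) _.
  by move=> w; rewrite lee_fin expR_ge0.
rewrite ge0_integralZl_EFin ?expR_ge0//; last 2 first.
- move=> w _; rewrite adde_ge0// mule_ge0 ?g0// lee_fin //.
  by rewrite subr_ge0.
- by apply: emeasurable_funD; apply: measurable_funeM; exact: mg.
rewrite (integral_conv l01 (g0 y) (g0 y') (mg y) (mg y') (Ig y) (Ig y')).
by rewrite mule1.
Qed.

Lemma integral_slice_le y : (B y <= (expR (- F y))%:E)%E.
Proof.
have := AB y; rewrite -expR_partial => H.
rewrite -[leLHS]mul1e (_ : 1%E = ((expR (- F y))%:E * (expR (F y))%:E)%E); last first.
  by rewrite -EFinM -expRD addNr expR0.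
rewrite -muleA -[leRHS]mule1; apply: lee_wpmul2l H.
by rewrite lee_fin expR_ge0.
Qed.

(** The jump splits into [k] in the first coordinate and [h] in the others. For fixed [h], the
    infimum over [k] produces [q] under the integral, which bounds [J] by [e^(F (y - h) + r)]; the
    infimum over [h] is then taken outside the integral. *)
Lemma integral_infc_slice_le (C : 'I_n.+1 -> R^o -> R -> Prop) y :
  (forall i, convex_cost (C i)) -> C ord0 = C0 ->
  (\int[P]_w (expR (infc (sum_cost C) f (consr (X w) y)))%:E <=
   (expR (infc (sum_cost (fun j => C (lift ord0 j))) F y))%:E)%E.
Proof.
move=> cC CE; pose C' j := C (lift ord0 j).
have cC' : convex_cost (sum_cost C') by apply: convex_cost_sum => j; exact: cC.
set J := (\int[P]_w _)%E.
have Jle h r : sum_cost C' h r -> (J <= (expR (F (y - h) + r))%:E)%E.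
  move=> hr; rewrite expRD EFinM expR_partial muleC -ge0_integralZl_EFin ?expR_ge0//; last first.
    by apply/measurable_EFinP; apply: measurableT_comp => //; exact: measurable_q.
  apply: ge0_le_integral_any => w; first by rewrite lee_fin expR_ge0.
  rewrite -EFinM -expRD lee_fin ler_expR addrC -lerBlDr.
  apply: infc_ge => [//||k s ks]; first exact: slice_lb.
  rewrite lerBlDr -addrA.
  have ks' : sum_cost C (consr k h) (s + r).
    by apply: sum_cost_consr => //; rewrite CE.
  apply: le_trans (infc_le (convex_cost_sum cC) _ _ ks') _; first by exists m.
  by rewrite consrB.
rewrite leNgt; apply/negP => lt.
have J0 : (0 < J)%E by apply: lt_trans lt; rewrite lte_fin expR_gt0.
have Jfin : J \is a fin_num.
  rewrite ge0_fin_numE ?ltW//.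
  by apply: le_lt_trans (Jle _ _ (cost00 cC')) _; rewrite ltry.
have J0' : 0 < fine J by rewrite fine_gt0// J0 ltey_eq Jfin.
move: lt; rewrite -(fineK Jfin) lte_fin -[fine J]lnK ?posrE// ltr_expR.
have fF : exists m, forall x, m <= F x by exists m; exact: partial_lb.
move=> /(infc_lt cC' fF)[h [r [hr]]]; apply/negP; rewrite -leNgt.
by rewrite -ler_expR lnK ?posrE// -lee_fin fineK//; exact: Jle.
Qed.

End partial_infc.

Theorem ic_sum_cost n (Y : 'I_n -> T -> R) (C : 'I_n -> R^o -> R -> Prop) :
  (forall i, measurable_fun setT (Y i)) -> mutually_independent P Y ->
  (forall i, convex_cost (C i)) -> (forall i, ic_ineq (Y i : T -> R^o) (C i)) ->
  ic_ineq (rvec Y : T -> 'rV[R]_n) (sum_cost C).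
Proof.
elim: n Y C => [|n IH] Y C mY iY cC icC f cf fb.
  have E w : rvec Y w = 0 by apply/rowP => -[].
  under eq_integral do rewrite E.
  under [X in (_ * X)%E]eq_integral do rewrite E.
  rewrite !integral_cst//= probability_setT !mule1 -EFinM -expRD lee_fin.
  rewrite expR_le1 subr_le0; apply: infc_le_id => //.
  exact: convex_cost_sum.
have [m fm] := fb.
have cCn := convex_cost_sum cC.
pose Z j := Y (lift ord0 j).
pose g1 (v : borel_rV R n.+1) := (expR (infc (sum_cost C) f v))%:E.
pose g2 (v : borel_rV R n.+1) := (expR (- f v))%:E.
have E1 : (\int[P]_w g1 (rvec Y w) =
    \int[P]_w' \int[P]_w g1 (consr (Y ord0 w) (rvec Z w')))%E.
  apply: integral_decouple => // [|v]; last by rewrite lee_fin expR_ge0.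
  by apply/measurable_EFinP; apply: measurableT_comp => //; exact: measurable_infc_rV.
have E2 : (\int[P]_w g2 (rvec Y w) =
    \int[P]_w' \int[P]_w g2 (consr (Y ord0 w) (rvec Z w')))%E.
  apply: integral_decouple => // [|v]; last by rewrite lee_fin expR_ge0.
  apply/measurable_EFinP; apply: measurableT_comp => //; apply: measurable_funN.
  apply: measurable_fun_lt => t; apply: sub_sigma_algebra.
  apply: (@open_comp _ _ f [set x | x < t]) => [v _|]; last exact: open_lt.
  exact: cvx_rV_continuous.
rewrite [X in (X * _)%E]E1 [X in (_ * X)%E]E2.
pose F y := ln (fine (\int[P]_w
  (expR (infc (C ord0) (fun x : R^o => f (consr x y)) (Y ord0 w)))%:E)).
have cF : cvx F := cvx_partial (cC ord0) cf fm (mY ord0) (icC ord0).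
have Fm y : m <= F y := partial_lb (cC ord0) cf fm (mY ord0) (icC ord0) y.
apply: le_trans (IH Z (fun j => C (lift ord0 j)) _ _ _ _ F cF _); last 5 first.
- by move=> j; exact: mY.
- exact: mutually_independent_tail.
- by move=> j; exact: cC.
- by move=> j; exact: icC.
- by exists m.
apply: lee_pmul.
- by apply: integral_ge0 => w' _; apply: integral_ge0 => w _; rewrite lee_fin expR_ge0.
- by apply: integral_ge0 => w' _; apply: integral_ge0 => w _; rewrite lee_fin expR_ge0.
- apply: ge0_le_integral_any => w'.
    by apply: integral_ge0 => w _; rewrite lee_fin expR_ge0.
  exact: (integral_infc_slice_le (cC ord0) cf fm (mY ord0) (icC ord0)).
- apply: ge0_le_integral_any => w'.
    by apply: integral_ge0 => w _; rewrite lee_fin expR_ge0.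
  exact: (integral_slice_le (cC ord0) cf fm (mY ord0) (icC ord0)).
Qed.

End tensorization.

(** * The Legendre transform of a vector with independent coordinates *)

Section independent_coordinates.
Context {R : realType} d (T : measurableType d) (P : probability T R).

(** Multiplicativity of moment generating functions, in terms of real lower bounds so as to cover
    infinite values. *)
Lemma mgf_sum n (Y : 'I_n -> T -> R) (y s : 'I_n -> R) :
  (forall i, measurable_fun setT (Y i)) -> mutually_independent P Y ->
  (forall i, ((expR (s i))%:E <= \int[P]_w (expR (y i * Y i w))%:E)%E) ->
  ((expR (\sum_i s i))%:E <= \int[P]_w (expR (\sum_i y i * Y i w))%:E)%E.
Proof.
elim: n Y y s => [|n IH] Y y s mY iY H.
  rewrite big_ord0; under eq_integral do rewrite big_ord0.
  by rewrite integral_cst//= probability_setT mule1.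
pose Z j := Y (lift ord0 j).
pose k w' := \sum_j y (lift ord0 j) * Z j w'.
pose g (v : borel_rV R n.+1) := (expR (\sum_i y i * (v : 'rV[R]_n.+1) ord0 i))%:E.
have -> : (\int[P]_w (expR (\sum_i y i * Y i w))%:E = \int[P]_w g (rvec Y w))%E.
  apply: eq_integral => w _; congr (expR _)%:E.
  by apply: eq_bigr => i _; rewrite mxE.
rewrite integral_decouple//; last 2 first.
- apply/measurable_EFinP; apply: measurableT_comp => //.
  apply: measurable_sum => i; apply: measurable_funM => //.
  exact: measurable_coord.
- by move=> v; rewrite lee_fin expR_ge0.
have mY0 : measurable_fun setT (fun w => (expR (y ord0 * Y ord0 w))%:E).
  apply/measurable_EFinP; apply: measurableT_comp => //; exact: measurable_funM.
apply: (@le_trans _ _ (\int[P]_w' ((expR (s ord0))%:E * (expR (k w'))%:E))%E).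
  rewrite ge0_integralZl_EFin ?expR_ge0//.
    rewrite big_ord_recl expRD EFinM lee_wpmul2l ?lee_fin ?expR_ge0//.
    apply: IH => [j||j].
    - exact: mY.
    - exact: mutually_independent_tail.
    - exact: H.
  apply/measurable_EFinP; apply: measurableT_comp => //.
  by apply: measurable_sum => j; apply: measurable_funM => //; exact: mY.
apply: ge0_le_integral_any => w'.
  by rewrite mule_ge0 ?lee_fin ?expR_ge0.
rewrite muleC; apply: (@le_trans _ _
    (\int[P]_w ((expR (k w'))%:E * (expR (y ord0 * Y ord0 w))%:E))%E).
  rewrite ge0_integralZl_EFin ?expR_ge0//.
  by rewrite lee_wpmul2l ?lee_fin ?expR_ge0.
rewrite le_eqVlt; apply/orP; left; apply/eqP; apply: eq_integral => w _.
rewrite -EFinM -expRD /g big_ord_recl consr0 addrC.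
congr (expR (_ + _))%:E; apply: eq_bigr => j _.
by rewrite consr_lift mxE.
Qed.

Lemma le_lne (u : R) (L : \bar R) : ((expR u)%:E <= L)%E -> (u%:E <= lne L)%E.
Proof.
move=> H; rewrite -lee_expeR/=.
have /eqP -> // : expeR (lne L) == L.
by rewrite lneK_eq; apply: le_trans H; rewrite lee_fin expR_ge0.
Qed.

Lemma cumulant_gfE n (X : T -> 'rV[R]_n) y :
  cumulant_gf P X y = lne (\int[P]_w (expR (dotr y (X w)))%:E)%E.
Proof. by rewrite /cumulant_gf unlock. Qed.

(** Independence makes the cumulant-generating function additive, so bounds on the rates of the
    coordinates add up. *)
Lemma legendre_le n (X : T -> 'rV[R]_n) (h : 'rV[R]_n) (rho : 'I_n -> R) :
  (forall i, measurable_fun setT (coordinate X i)) ->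
  mutually_independent P (coordinate X) ->
  (forall i y, ((expR (h ord0 i * y - rho i))%:E <=
     \int[P]_w (expR (y * coordinate X i w))%:E)%E) ->
  (legendre (cumulant_gf P X) h <= (\sum_i rho i)%:E)%E.
Proof.
move=> mX iX H; apply: ge_ereal_sup => _ [y _ <-].
have L : ((dotr h y - \sum_i rho i)%:E <= cumulant_gf P X y)%E.
  rewrite cumulant_gfE; apply: le_lne; rewrite /dotr -sumrB.
  exact: (mgf_sum mX iX (fun i => H i (y ord0 i))).
case: (cumulant_gf P X y) L => [c||]//.
  by rewrite -EFinB !lee_fin; lra.
by move=> _; rewrite leNye.
Qed.

Lemma infconv_le_infc n (phi : 'rV[R]_n -> \bar R) (C : 'rV[R]_n -> R -> Prop) f x :
  convex_cost C -> (exists m, forall x, m <= f x) ->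
  (forall h r, C h r -> (phi h <= r%:E)%E) ->
  (infconv f phi x <= (infc C f x)%:E)%E.
Proof.
move=> cC fb H; apply/lee_addgt0Pr => e e0.
have [|h [r [hr lt]]] := @infc_lt _ _ _ _ cC fb x (infc C f x + e); first by rewrite ltrDl.
apply: (@le_trans _ _ ((f (x - h)%R)%:E + phi h)%E).
  by apply: ereal_inf_lbound; exists (x - h) => //; rewrite subKr.
apply: (@le_trans _ _ ((f (x - h)%R)%:E + r%:E)%E); first by rewrite leeD2l// H.
by rewrite -!EFinD lee_fin ltW.
Qed.

End independent_coordinates.

Section coordinate_law.
Context {R : realType} d (T : measurableType d) (P : probability T R) (n : nat).
Variables (X : {RV P >-> borel_rV R n}) (i : 'I_n).

Lemma measurable_coordinate : measurable_fun setT (coordinate X i).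
Proof. exact: (measurableT_comp (measurable_coord i) (measurable_funPT X)). Qed.

Let Y : {RV P >-> measurableTypeR R} :=
  @mfun_Sub _ _ T (measurableTypeR R) (coordinate X i) (mem_set measurable_coordinate).

Definition law : probability (measurableTypeR R) R := distribution P Y.

Lemma lawE A : law A = P (coordinate X i @^-1` A).
Proof. by []. Qed.

Lemma integral_law (g : R -> \bar R) :
  measurable_fun [set: measurableTypeR R] g -> (forall x, (0 <= g x)%E) ->
  (\int[law]_x g x = \int[P]_w g (coordinate X i w))%E.
Proof. by move=> mg g0; rewrite /law ge0_integral_distribution. Qed.

Lemma symmetric_law : symmetric_rV X -> symmetric_measure law.
Proof.
move=> sX A mA; rewrite !lawE.
pose cA := (fun v : borel_rV R n => (v : 'rV[R]_n) ord0 i) @^-1` A.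
have mcA : measurable cA.
  by rewrite -[X in measurable X]setTI; exact: measurable_coord.
transitivity (P (X @^-1` cA)); first by [].
rewrite (sX _ mcA); congr (P _); apply/seteqP.
by split => w; rewrite /preimage/cA/= mxE.
Qed.

Lemma star_tail_law : log_concave_tails P (coordinate X i) -> star_tail law.
Proof.
move=> H t l t0 l01 St; have := H 0 t l (lexx 0) t0 l01.
have E s : P [set w | s <= `|coordinate X i w|] = (tail law s)%:E.
  by rewrite -tailE lawE.
rewrite /neg_log_tail mulr0 add0r !E tail0 (lne_EFin ltr01) ln1 oppe0 mule0 add0e.
rewrite (lne_EFin St) => H1.
(* A vanishing tail at [l * t] would make the left-hand side of [H1] infinite, while the right-hand
   side is finite. *)
have S0 : 0 < tail law (l * t).
  rewrite lt_neqAle tail_ge0 andbT; apply/eqP => S0.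
  by move: H1; rewrite -S0 /= lexx.
move: H1; rewrite lne_EFin// -!EFinN -EFinM lee_fin mulrN lerN2 => H1.
by rewrite -ler_ln ?posrE ?expR_gt0// expRK.
Qed.

End coordinate_law.

Theorem corollary2p2 (R : realType) :
  exists beta : R, 0 < beta <= 1680 * expR 1 /\
    forall (n : nat), (1 <= n)%N ->
    forall (d : measure_display) (T : measurableType d) (P : probability T R)
      (X : {RV P >-> borel_rV R n}),
      symmetric_rV X ->
      independent_family P (coordinate X) ->
      (forall i : 'I_n, log_concave_tails P (coordinate X i)) ->
      convex_IC X beta.
Proof.
exists (60 * 56); split.
  apply/andP; split; first by rewrite mulr_gt0.
  rewrite (_ : (60 * 56 : R) = 1680 * 2); last by rewrite -!natrM.
  apply: ler_wpM2l; [exact: ler0n|exact: expR1_ge].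
move=> n _ d T P X sX iX lcX.
set beta : R := 60 * 56; have betaE : beta = 60 * 56 by []; clearbody beta.
move=> f /convex_function_cvx cf fb.
pose Y := coordinate X.
have mY i : measurable_fun setT (Y i) by exact: measurable_coordinate.
have iY : mutually_independent P Y.
  move=> B mB; have := iX [set: 'I_n]%SET B mB.
  rewrite (_ : \bigcap_(i in _) _ = rvec Y @^-1` rbox B); last first.
    apply/seteqP; split => w h i; first by rewrite /= mxE; apply: h; rewrite /= inE.
    by have := h i; rewrite /= mxE.
  by move=> ->; apply: eq_bigl => i; rewrite inE.
have XE w : X w = rvec Y w by apply/rowP => i; rewrite mxE.
pose C i : R^o -> R -> Prop := cost (law X i) beta.
have cC i : convex_cost (C i) by apply: convex_cost_rate; exact: symmetric_law.
have icY i : ic_ineq P (Y i : T -> R^o) (C i).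
  move=> g cg gb; have := ic_real (symmetric_law i sX) (star_tail_law (lcX i)) betaE cg gb.
  rewrite !integral_law//.
    exact: measurable_expRN_cvx.
  exact: measurable_expR_infc (cC i) cg gb.
apply: le_trans (ic_sum_cost mY iY cC icY cf fb).
have -> : ('E_P[fun w => expR (- f (X w))] = \int[P]_w (expR (- f (rvec Y w)))%:E)%E.
  by rewrite unlock; apply: eq_integral => w _; rewrite XE.
apply: lee_wpmul2r; first by apply: integral_ge0 => w _; rewrite lee_fin expR_ge0.
apply: ge0_le_integral_any => w; first exact: expeR_ge0.
rewrite XE -[leRHS]/(expeR (infc (sum_cost C) f (rvec Y w))%:E) lee_expeR.
apply: infconv_le_infc => //; first exact: convex_cost_sum.
move=> h r [rho [hr ->]]; apply: legendre_le => // i y.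
have := hr i y; rewrite /mgf integral_law.
- by rewrite mxE.
- exact: measurable_expRM.
- by move=> x; rewrite lee_fin expR_ge0.
Qed.
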